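(* For any stabilizer code $Q$ that is free of Bell pairs and trivially encoded qubits, and for all $r\ge 1$, the set $\mathrm{Trans}(Q^{\otimes r})$ of transversal $r$-qubit gates is not an encoded computationally universal set of gates for even one of the logical qubits of $Q$.
   Context: The $n$-qubit Pauli group $\mathcal G_n$ consists of all operators $\alpha R_1\otimes\cdots\otimes R_n$ with $\alpha\in\{\pm1,\pm i\}$ and $R_i\in\{I,X,Y,Z\}$. A stabilizer $\mathcal S$ is an abelian subgroup of $\mathcal G_n$ not containing $-I$; the ($n$-qubit) stabilizer code is $Q=\{|\psi\rangle\in(\mathbb C^2)^{\otimes n}: R|\psi\rangle=|\psi\rangle\ \forall R\in\mathcal S\}$, of dimension $2^k$ where $|\mathcal S|=2^{n-k}$; $k$ is the number of logical qubits, and $P_Q$ is the orthogonal projector onto $Q$. With $\mathcal C(\mathcal S)$ the set of elements of $\mathcal G_n$ commuting with all of $\mathcal S$, the isomorphism $\mathcal C(\mathcal S)/\mathcal S\cong\mathcal G_k$ associates the $k$ logical qubits to logical Pauli operators $\bar X_i,\bar Z_i$, $i=1,\dots,k$, obeying the commutation relations of $\mathcal G_k$. $Q$ is free of Bell pairs if it cannot be written as a tensor product of a stabilizer code and a $[[2,0,2]]$ code (a Bell pair, i.e. a two-qubit stabilizer state whose stabilizer has four elements, all non-identity ones acting nontrivially on both qubits). $Q$ is free of trivially encoded qubits if for each $j\in\{1,\dots,n\}$ some element of $\mathcal S$ has $j$-th tensor factor different from the identity. For a positive integer $r$, $Q^{\otimes r}$ is the code on $nr$ qubits consisting of $r$ blocks,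 each encoded in $Q$. Its logical gates are $\mathbb V(Q^{\otimes r})=\{U\in SU(2^{nr}) : [U,P_Q^{\otimes r}]=0\}$. A transversal $r$-qubit gate on $Q^{\otimes r}$ is a $U\in\mathbb V(Q^{\otimes r})$ of the form $U=\bigotimes_{j=1}^n U_j$, where $U_j\in SU(2^r)$ acts only on the $j$-th qubit of each block; $\mathrm{Trans}(Q^{\otimes r})$ is the set of these. A set $A$ of logical gates on blocks of $Q$ is encoded computationally universal if, for any number $N$ of blocks and any $U\in\mathbb V(Q^{\otimes N})$, for every $\epsilon>0$ there exist $V_1,\dots,V_{\eta(\epsilon)}\in A$ such that $\|UP_Q^{\otimes N}-(\prod_i V_i)P_Q^{\otimes N}\|<\epsilon$ (operator norm); here gates in $A$ may be implicitly mapped to isometries on the appropriate Hilbert space. Universality for one of the logical qubits of $Q$ means that universal quantum computation in this sense can be performed on that encoded qubit. *)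

(* Defs.v *)
(* Scalars are R[i], the complex numbers over R : realType. *)
From HB Require Import structures.
From mathcomp Require Import all_boot all_order all_algebra.
From mathcomp Require Import all_classical all_reals.
From mathcomp Require Import complex.

Set Implicit Arguments.
Unset Strict Implicit.
Unset Printing Implicit Defensive.

Import Order.TTheory GRing.Theory Num.Theory.
Local Open Scope classical_set_scope.
Local Open Scope sesquilinear_scope.
Local Open Scope ring_scope.

(* The qubits of a system are labelled by a finite type T; the computational
   basis of its Hilbert space is {ffun T -> bool}, and states and operators are
   MathComp vectors and matrices over the canonical enumeration of that type. *)
Notation qstate R T := 'cV[R[i]]_#|{ffun T -> bool}|.
Notation qop R T := 'M[R[i]]_#|{ffun T -> bool}|.

Section Qubits.
Variable R : realType.
Implicit Types T J I : finType.

Definition qop_of T (f : {ffun T -> bool} -> {ffun T -> bool} -> R[i]) :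
  qop R T := \matrix_(x, y) f (enum_val x) (enum_val y).

Definition entry T (A : qop R T) (x y : {ffun T -> bool}) : R[i] :=
  A (enum_rank x) (enum_rank y).

Definition restr T J (f : J -> T) (x : {ffun T -> bool}) : {ffun J -> bool} :=
  [ffun j => x (f j)].

(* The operator A applied to the qubits f j (f injective), identity on the
   qubits outside the range of f. *)
Definition act_on T J (f : J -> T) (A : qop R J) : qop R T :=
  qop_of (fun x y => entry A (restr f x) (restr f y) *
    ([forall t, (t \notin codom f) ==> (x t == y t)])%:R).

(* The tensor product of the A i, where A i acts on the qubits pos i j; meant
   for pos inducing a bijection from I * J to T. *)
Definition tensor_op T I J (pos : I -> J -> T) (A : I -> qop R J) : qop R T :=
  qop_of (fun x y => \prod_i entry (A i) (restr (pos i) x) (restr (pos i) y)).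

Definition special_unitary m (U : 'M[R[i]]_m) : Prop :=
  U \is unitarymx /\ \det U = 1.

Definition norm2 m (v : 'cV[R[i]]_m) : R :=
  Num.sqrt (\sum_i (complex.Re (v i 0) ^+ 2 + complex.Im (v i 0) ^+ 2)).

Definition opnorm m (A : 'M[R[i]]_m) : R :=
  sup [set norm2 (A *m v) | v in [set v : 'cV[R[i]]_m | norm2 v <= 1]].

Inductive pauli := PauliI | PauliX | PauliY | PauliZ.

(* Entry of the 2 x 2 matrix in row a, column b, with false for 0, true for 1. *)
Definition pauli_entry (p : pauli) (a b : bool) : R[i] :=
  match p with
  | PauliI => (a == b)%:R
  | PauliX => (a != b)%:R
  | PauliY => if a == b then 0 else if a then 'i%C else - 'i%C
  | PauliZ => if a == b then (-1) ^+ a else 0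
  end.

Definition pauli_op T (a : nat) (w : T -> pauli) : qop R T :=
  qop_of (fun x y => 'i%C ^+ a * \prod_t pauli_entry (w t) (x t) (y t)).

Definition pauli_group T : set (qop R T) :=
  [set A | exists a w, A = pauli_op a w].

Definition is_stabilizer T (S : set (qop R T)) : Prop :=
  [/\ S `<=` pauli_group (T := T),
      S 1%:M,
      (forall A B, S A -> S B -> S (A *m B) /\ S (invmx A)),
      (forall A B, S A -> S B -> A *m B = B *m A)
    & ~ S (- 1%:M)].

Definition code T (S : set (qop R T)) : set (qstate R T) :=
  [set psi | forall A, S A -> A *m psi = psi].

Definition is_orth_projector m (E : set 'cV[R[i]]_m) (P : 'M[R[i]]_m) : Prop :=
  [/\ P *m P = P, P ^t* = P & forall v, E v <-> P *m v = v].

(* P_Q; the default value 0 is never used, as an orthogonal projector onto a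
   linear subspace exists and is unique. *)
Definition projector T (S : set (qop R T)) : qop R T :=
  xget 0 [set P | is_orth_projector (code S) P].

Definition tensor_state T J1 J2 (f : J1 -> T) (g : J2 -> T)
    (phi : qstate R J1) (chi : qstate R J2) : qstate R T :=
  \col_x (phi (enum_rank (restr f (enum_val x))) 0 *
          chi (enum_rank (restr g (enum_val x))) 0).

Definition tensor_space T J1 J2 (f : J1 -> T) (g : J2 -> T)
    (E1 : set (qstate R J1)) (E2 : set (qstate R J2)) : set (qstate R T) :=
  [set psi | exists m (phi : 'I_m -> qstate R J1) (chi : 'I_m -> qstate R J2),
     (forall i, E1 (phi i) /\ E2 (chi i)) /\
     psi = \sum_i tensor_state f g (phi i) (chi i)].

Definition is_bell_stabilizer (S : set (qop R 'I_2)) : Prop :=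
  [/\ is_stabilizer S,
      (S #= `I_4)%card
    & forall a w, S (pauli_op a w) -> pauli_op a w <> 1%:M ->
        forall j, w j <> PauliI].

Definition free_of_bell_pairs n (S : set (qop R 'I_n)) : Prop :=
  ~ exists m (f : 'I_m + 'I_2 -> 'I_n)
      (S1 : set (qop R 'I_m)) (S2 : set (qop R 'I_2)),
      [/\ bijective f, is_stabilizer S1, is_bell_stabilizer S2
        & code S = tensor_space (f \o inl) (f \o inr) (code S1) (code S2)].

Definition free_of_trivial_qubits n (S : set (qop R 'I_n)) : Prop :=
  forall j, exists a w, S (pauli_op a w) /\ w j <> PauliI.

Definition centralizer T (S : set (qop R T)) : set (qop R T) :=
  [set A | pauli_group A /\ forall B, S B -> A *m B = B *m A].

(* Representatives in C(S) of the images of X_i and Z_i under an isomorphism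
   from G_k to C(S)/S. Relations modulo S are equalities here, since products
   and commutators involved are +-1 and -1 is not in S. *)
Definition logical_paulis T k (S : set (qop R T)) (X Z : 'I_k -> qop R T) :
    Prop :=
  [/\ forall i, centralizer S (X i) /\ centralizer S (Z i),
      forall i, X i *m X i = 1%:M /\ Z i *m Z i = 1%:M,
      forall i j, X i *m X j = X j *m X i /\ Z i *m Z j = Z j *m Z i
    & forall i j, X i *m Z j = (-1) ^+ (i == j) *: (Z j *m X i)].

(* In N blocks of n qubits, the qubit (b, j) is the j-th qubit of block b. *)

Definition block_projector n (S : set (qop R 'I_n)) N :
    qop R ('I_N * 'I_n)%type :=
  tensor_op (fun b j => (b, j)) (fun _ : 'I_N => projector S).

Definition logical_gates n (S : set (qop R 'I_n)) N :
    set (qop R ('I_N * 'I_n)%type) :=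
  [set U | special_unitary U /\
           U *m block_projector S N = block_projector S N *m U].

Definition trans_gates n (S : set (qop R 'I_n)) r :
    set (qop R ('I_r * 'I_n)%type) :=
  [set U | logical_gates S (N := r) U /\
     exists V : 'I_n -> qop R 'I_r,
       (forall j, special_unitary (V j)) /\
       U = tensor_op (fun j b => (b, j)) V].

(* The gates on N blocks obtained by applying a gate of A to r distinct blocks,
   in any order, and the identity to the others. *)
Definition placed n r N (A : set (qop R ('I_r * 'I_n)%type)) :
    set (qop R ('I_N * 'I_n)%type) :=
  [set V | exists (f : 'I_r -> 'I_N) (W : qop R ('I_r * 'I_n)%type),
     [/\ injective f, A W & V = act_on (fun p => (f p.1, p.2)) W]].

Definition approximable n (S : set (qop R 'I_n)) N
    (G : set (qop R ('I_N * 'I_n)%type)) (U : qop R ('I_N * 'I_n)%type) : Prop :=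
  forall eps : R, 0 < eps ->
  exists Vs : seq (qop R ('I_N * 'I_n)%type),
    (forall V, V \in Vs -> G V) /\
    opnorm (U *m block_projector S N -
            (\big[mulmx/1%:M]_(V <- Vs) V) *m block_projector S N) < eps.

(* On the code space of N blocks, U acts on the q-th logical qubits of the
   blocks only: it commutes with every logical Pauli operator of every other
   logical qubit. *)
Definition acts_on_logical_qubit n k (S : set (qop R 'I_n))
    (X Z : 'I_k -> qop R 'I_n) (q : 'I_k) N
    (U : qop R ('I_N * 'I_n)%type) : Prop :=
  forall (b : 'I_N) (i : 'I_k), i != q ->
  forall L, L = X i \/ L = Z i ->
  let Lb := act_on (fun j => (b, j)) L in
  U *m Lb *m block_projector S N = Lb *m U *m block_projector S N.

(* N >= r because a gate of A needs r blocks to act on. Gates U on fewer blocks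
   are covered: they are U (x) 1 on r blocks. *)
Definition universal_for_logical_qubit n k (S : set (qop R 'I_n))
    (X Z : 'I_k -> qop R 'I_n) (q : 'I_k) r
    (A : set (qop R ('I_r * 'I_n)%type)) : Prop :=
  forall N, (r <= N)%N ->
  forall U, logical_gates S U -> acts_on_logical_qubit S X Z q U ->
  approximable S (placed (N := N) A) U.

End Qubits.

Arguments block_projector {R n} S N.
Arguments logical_gates {R n} S N _.
Arguments trans_gates {R n} S r _.

(* Main.v *)
Require Import Defs.
From HB Require Import structures.
From mathcomp Require Import all_boot all_order all_algebra.
From mathcomp Require Import all_classical all_reals.
From mathcomp Require Import complex ring lra trigo.

(** An infinitesimal version of the Eastin-Knill argument. If H is a sum of
operators acting on single columns (the j-th qubits of all r blocks) and
commutes with the code projector P, then H P = P H P is a sum of compressions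
of single-column operators. Expanding in Pauli operators, only those commuting
with S survive, and since some element of S acts nontrivially on each qubit,
the surviving ones on one qubit lie in {I, sigma} for a single Pauli sigma.
Hence all these compressions commute. A transversal gate near the identity has
a logarithm of this form, so transversal gates near the identity commute on the
code space. By compactness, among sufficiently many transversal gates two are
close; applied to approximations of many rotations generated by the logical X_q
and of many generated by the logical Z_q, this gives two quotients that nearly
commute on the code space, whereas the exact quotients do not. *)

Set Implicit Arguments.
Unset Strict Implicit.
Unset Printing Implicit Defensive.

Import Order.TTheory GRing.Theory Num.Theory.
Local Open Scope classical_set_scope.
Local Open Scope sesquilinear_scope.
Local Open Scope ring_scope.

(** * Operators on labelled qubits *)

Section Operators.
Variable R : realType.
Local Notation C := R[i].
Implicit Types T J I : finType.

Lemma entry_qop_of T (f : {ffun T -> bool} -> {ffun T -> bool} -> C) x y :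
  entry (qop_of f) x y = f x y.
Proof. by rewrite /entry mxE !enum_rankK. Qed.

Lemma qop_eq T (A B : qop R T) :
  (forall x y, entry A x y = entry B x y) -> A = B.
Proof.
move=> AB; apply/matrixP => i j.
by have := AB (enum_val i) (enum_val j); rewrite /entry !enum_valK.
Qed.

Lemma entry_mul T (A B : qop R T) x y :
  entry (A *m B) x y = \sum_z entry A x z * entry B z y.
Proof.
rewrite /entry mxE (reindex_omap enum_rank (fun i => Some (enum_val i))) /=.
  by apply: eq_bigl => z; rewrite enum_rankK eqxx.
by move=> i _; rewrite enum_valK.
Qed.

Lemma entry_1 T x y : entry (1%:M : qop R T) x y = (x == y)%:R.
Proof. by rewrite /entry mxE (inj_eq enum_rank_inj). Qed.

Lemma entry_adj T (A : qop R T) x y : entry (A ^t*) x y = (entry A y x)^*%C.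
Proof. by rewrite /entry !mxE. Qed.

Lemma entry_add T (A B : qop R T) x y :
  entry (A + B) x y = entry A x y + entry B x y.
Proof. by rewrite /entry mxE. Qed.

Lemma entry_scale T a (A : qop R T) x y : entry (a *: A) x y = a * entry A x y.
Proof. by rewrite /entry mxE. Qed.

Lemma adj_mul n (A B : 'M[C]_n) : (A *m B) ^t* = B ^t* *m A ^t*.
Proof. by rewrite trmx_mul map_mxM. Qed.

Lemma adj1 n : (1%:M : 'M[C]_n) ^t* = 1%:M.
Proof. by rewrite trmx1 map_mx1. Qed.

Lemma unitary_adjl n (U : 'M[C]_n) : U \is unitarymx -> U ^t* *m U = 1%:M.
Proof. by move=> Uu; rewrite -invmx_unitary// mulVmx// unitarymx_unit. Qed.

Lemma comm_mx_adj n (A B : 'M[C]_n) : comm_mx A B -> comm_mx (A ^t*) (B ^t*).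
Proof. by move=> AB; rewrite /comm_mx -!adj_mul AB. Qed.

Lemma comm_mxZ n a (A B : 'M[C]_n) : comm_mx A B -> comm_mx A (a *: B).
Proof. by move=> AB; rewrite /comm_mx -scalemxAr -scalemxAl AB. Qed.

(** Written with identity factors elsewhere, so that products, adjoints and commutation are checked
    factor by factor; [act_on_local] relates it to [act_on]. *)
Definition local T I J (pos : I -> J -> T) (i : I) (A : qop R J) : qop R T :=
  tensor_op pos (fun i' => if i' == i then A else 1%:M).

Section Tensor.
Variables (T I J : finType) (pos : I -> J -> T).
Hypothesis posP : bijective (fun p => pos p.1 p.2).
Implicit Types (A B : I -> qop R J) (D E : qop R J).

Let states := {ffun T -> bool}.

Lemma restr_all_eq (x y : states) :
  (x == y) = [forall i, restr (pos i) x == restr (pos i) y].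
Proof.
have [g _ gK] := posP; apply/eqP/forallP => [-> //|xy].
apply/ffunP => t; rewrite -(gK t).
by have /eqP/ffunP/(_ (g t).2) := xy (g t).1; rewrite !ffunE.
Qed.

Lemma restr_bij :
  bijective (fun z : states => [ffun i => restr (pos i) z] : {ffun I -> {ffun J -> bool}}).
Proof.
have [g fK gK] := posP.
exists (fun u : {ffun I -> {ffun J -> bool}} => [ffun t => u (g t).1 (g t).2]).
  by move=> z; apply/ffunP => t; rewrite !ffunE gK.
move=> u; apply/ffunP => i; apply/ffunP => j; rewrite !ffunE.
by rewrite (fK (i, j)).
Qed.

Lemma entry_tensor A x y :
  entry (tensor_op pos A) x y =
  \prod_i entry (A i) (restr (pos i) x) (restr (pos i) y).
Proof. exact: entry_qop_of. Qed.

(** Distributivity turns the product of sums into a sum over families of basis states of the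
    factors, which [restr_bij] identifies with basis states of the whole system. *)
Lemma tensor_mul A B :
  tensor_op pos A *m tensor_op pos B = tensor_op pos (fun i => A i *m B i).
Proof.
apply: qop_eq => x y; rewrite entry_mul entry_tensor.
under [RHS]eq_bigr do rewrite entry_mul.
rewrite bigA_distr_bigA (reindex _ (onW_bij _ restr_bij)).
apply: eq_bigr => z _; rewrite !entry_tensor -big_split /=.
by apply: eq_bigr => i _; rewrite ffunE.
Qed.

Lemma tensor_ext A B : A =1 B -> tensor_op pos A = tensor_op pos B.
Proof.
move=> AB; apply: qop_eq => x y; rewrite !entry_tensor.
by apply: eq_bigr => i _; rewrite AB.
Qed.

Lemma tensor_1 : tensor_op pos (fun=> 1%:M) = 1%:M :> qop R T.
Proof.
apply: qop_eq => x y; rewrite entry_tensor entry_1 restr_all_eq.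
under eq_bigr do rewrite entry_1.
case: forallP => [xy|/forallP]; first by apply: big1 => i _; rewrite xy.
by rewrite negb_forall => /existsP[i /negPf xy]; rewrite (bigD1 i)//= xy mul0r.
Qed.

Lemma tensor_adj A : (tensor_op pos A) ^t* = tensor_op pos (fun i => (A i) ^t*).
Proof.
apply: qop_eq => x y; rewrite entry_adj !entry_tensor rmorph_prod /=.
by apply: eq_bigr => i _; rewrite entry_adj.
Qed.

Lemma tensor_unitary A :
  (forall i, A i \is unitarymx) -> tensor_op pos A \is unitarymx.
Proof.
move=> Au; apply/unitarymxP; rewrite tensor_adj tensor_mul -tensor_1.
by apply: tensor_ext => i; apply/unitarymxP.
Qed.

Lemma tensor_comm A B : (forall i, comm_mx (A i) (B i)) ->
  comm_mx (tensor_op pos A) (tensor_op pos B).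
Proof. by move=> AB; rewrite /comm_mx !tensor_mul; apply: tensor_ext => i; apply: AB. Qed.

Lemma entry_local i D x y : entry (local pos i D) x y =
  entry D (restr (pos i) x) (restr (pos i) y) *
  [forall i', (i' != i) ==> (restr (pos i') x == restr (pos i') y)]%:R.
Proof.
rewrite /local entry_tensor (bigD1 i)//= eqxx; congr (_ * _).
case: forallP => [xy|/forallP].
  apply: big1 => i' ne; rewrite (negPf ne) entry_1.
  by have := xy i'; rewrite ne => /= ->.
rewrite negb_forall => /existsP[i']; rewrite negb_imply => /andP[ne /negPf xy].
by rewrite (bigD1 i')//= (negPf ne) entry_1 xy mul0r.
Qed.

Lemma localD i D E : local pos i (D + E) = local pos i D + local pos i E.
Proof. by apply: qop_eq => x y; rewrite entry_add !entry_local entry_add mulrDl. Qed.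

Lemma localZ i a D : local pos i (a *: D) = a *: local pos i D.
Proof. by apply: qop_eq => x y; rewrite entry_scale !entry_local entry_scale mulrA. Qed.

Lemma local_sum i K (r : seq K) (D : K -> qop R J) :
  local pos i (\sum_(k <- r) D k) = \sum_(k <- r) local pos i (D k).
Proof.
apply: (big_morph _ (localD i)).
by rewrite -[0](scale0r 0) localZ !scale0r.
Qed.

Lemma local_1 i : local pos i 1%:M = 1%:M.
Proof. by rewrite -tensor_1; apply: tensor_ext => i'; case: ifP. Qed.

Lemma localM i D E : local pos i (D *m E) = local pos i D *m local pos i E.
Proof.
by rewrite tensor_mul; apply: tensor_ext => i'; case: ifP; rewrite // mulmx1.
Qed.

Lemma local_adj i D : (local pos i D) ^t* = local pos i (D ^t*).
Proof.
by rewrite tensor_adj; apply: tensor_ext => i'; case: ifP; rewrite ?adj1.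
Qed.

Lemma tensor_local_conj A i D : (forall i, A i \is unitarymx) ->
  tensor_op pos (fun i => (A i) ^t*) *m local pos i D *m tensor_op pos A =
  local pos i ((A i) ^t* *m D *m A i).
Proof.
move=> Au; rewrite !tensor_mul; apply: tensor_ext => i'.
by case: eqP => [->//|_]; rewrite mulmx1 unitary_adjl.
Qed.

Lemma local_comm i i' D E : (i == i' -> comm_mx D E) ->
  comm_mx (local pos i D) (local pos i' E).
Proof.
move=> DE; apply: tensor_comm => i''.
case: eqP => [->|_]; last by apply/comm_mx_sym/comm_mx1.
by case: eqP => [/eqP/DE//|_]; apply: comm_mx1.
Qed.

Lemma act_on_local i D : act_on (pos i) D = local pos i D.
Proof.
apply: qop_eq => x y; rewrite entry_qop_of entry_local; congr (_ * (nat_of_bool _)%:R).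
have [g fK gK] := posP; apply/forallP/forallP => xy k; apply/implyP.
  move=> ne; apply/eqP/ffunP => j; rewrite !ffunE.
  have /implyP/(_ _)/eqP -> // := xy (pos k j).
  apply: contra ne => /codomP[j' /(congr1 g)].
  by rewrite (fK (k, j)) (fK (i, j')) => -[-> _].
rewrite -(gK k) => kn; have /implyP := xy (g k).1.
case: eqP => [e|_ /(_ isT)/eqP/ffunP/(_ (g k).2)]; last by rewrite !ffunE => ->.
by move: kn; rewrite e codom_f.
Qed.

End Tensor.
End Operators.

(** * Pauli operators and the code projector *)

Section Pauli.
Variable R : realType.
Local Notation C := R[i].

Definition pauli_mx (p : pauli) : qop R unit :=
  qop_of (fun x y => pauli_entry R p (x tt) (y tt)).

Definition pauli_anticommute (p q : pauli) : bool :=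
  match p, q with
  | PauliI, _ | _, PauliI | PauliX, PauliX | PauliY, PauliY | PauliZ, PauliZ =>
    false
  | _, _ => true
  end.

Lemma qubit_eq (D E : qop R unit) :
  (forall a b : bool, entry D [ffun=> a] [ffun=> b] = entry E [ffun=> a] [ffun=> b]) ->
  D = E.
Proof.
move=> DE; apply: qop_eq => x y.
suff e (z : {ffun unit -> bool}) : z = [ffun=> z tt] by rewrite (e x) (e y) DE.
by apply/ffunP => -[]; rewrite ffunE.
Qed.

Lemma entry_qubit_mul (D E : qop R unit) x y : entry (D *m E) x y =
  entry D x [ffun=> true] * entry E [ffun=> true] y +
  entry D x [ffun=> false] * entry E [ffun=> false] y.
Proof.
rewrite entry_mul (reindex (fun b : bool => [ffun=> b] : {ffun unit -> bool})) /=.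
  by rewrite big_bool.
exists (fun z => z tt) => [b _|z _]; first by rewrite ffunE.
by apply/ffunP => -[]; rewrite ffunE.
Qed.

Lemma entry_pauli p x y : entry (pauli_mx p) x y = pauli_entry R p (x tt) (y tt).
Proof. exact: entry_qop_of. Qed.

Lemma pauli_mxI : pauli_mx PauliI = 1%:M.
Proof.
apply: qubit_eq => a b; rewrite entry_pauli entry_1 !ffunE /=.
by case: eqP => [->|/eqP ab]; rewrite ?eqxx//; case: eqP => // /ffunP/(_ tt);
  rewrite !ffunE => /eqP; rewrite (negPf ab).
Qed.

Lemma pauli_mx_adj p : (pauli_mx p) ^t* = pauli_mx p.
Proof.
apply: qubit_eq => a b; rewrite entry_adj !entry_pauli !ffunE.
by case: p; case: a; case: b; apply/eqP; rewrite eq_complex /= ?oppr0 ?opprK !eqxx.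
Qed.

Ltac complex_cases := rewrite ?mulr0 ?mul0r ?addr0 ?add0r ?mulr1 ?mul1r
  ?expr0 ?expr1 ?mulN1r ?mulrN1 ?mulrN ?mulNr ?opprK ?oppr0 //=.

Lemma pauli_mx_comm p q : pauli_mx p *m pauli_mx q =
  (-1) ^+ pauli_anticommute p q *: (pauli_mx q *m pauli_mx p).
Proof.
apply: qubit_eq => a b; rewrite entry_scale !entry_qubit_mul !entry_pauli !ffunE.
by case: p; case: q; case: a; case: b; rewrite /=; complex_cases.
Qed.

Lemma pauli_mx_sqr p : pauli_mx p *m pauli_mx p = 1%:M.
Proof.
rewrite -pauli_mxI.
apply: qubit_eq => a b; rewrite !entry_qubit_mul !entry_pauli !ffunE.
case: p; case: a; case: b; rewrite /=; complex_cases;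
by rewrite -expr2 sqr_i opprK.
Qed.

Lemma pauli_mx_span (D : qop R unit) : exists c : pauli -> C,
  D = \sum_(p <- [:: PauliI; PauliX; PauliY; PauliZ]) c p *: pauli_mx p.
Proof.
pose d (a b : bool) := entry D [ffun=> a] [ffun=> b].
(* The Pauli matrices are orthogonal for the trace form: the coefficient at [p] is half the trace of
   [pauli_mx p *m D]. *)
exists (fun p => match p with
  | PauliI => (d false false + d true true) / 2
  | PauliX => (d false true + d true false) / 2
  | PauliY => 'i%C * (d false true - d true false) / 2
  | PauliZ => (d false false - d true true) / 2 end).
apply: qubit_eq => a b; rewrite !big_cons big_nil addr0.
have n2 : (2 : C) != 0 by rewrite pnatr_eq0.
have ii : ('i%C : C) * 'i%C = -1 by rewrite -expr2 sqr_i.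
rewrite !entry_add !entry_scale !entry_pauli !ffunE -/(d a b).
by case: a; case: b; rewrite /=; complex_cases; field: ii.
Qed.

End Pauli.

(** * Stabilizer groups and their projectors *)

Section Stabilizer.
Variables (R : realType) (n : nat).
Local Notation C := R[i].
Implicit Types (S : set (qop R 'I_n)) (A B : qop R 'I_n) (D E : qop R unit).

Lemma eq_opp_mx0 m p (A : 'M[C]_(m, p)) : A = - A -> A = 0.
Proof.
move=> AN; have : (2%:R : C) *: A = 0 by rewrite scaler_nat mulr2n {1}AN addNr.
by move/eqP; rewrite scaler_eq0 pnatr_eq0 => /eqP.
Qed.

(** The dummy [unit] index makes each qubit a tensor factor of its own, so that [tensor_op] covers
    Pauli operators up to a phase. *)
Definition site (j : 'I_n) (_ : unit) : 'I_n := j.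

Lemma site_bij : bijective (fun p => site p.1 p.2).
Proof. by exists (fun j => (j, tt)) => [[j []]|j]. Qed.

Lemma pauli_op_tensor a (w : 'I_n -> pauli) :
  pauli_op R a w = 'i%C ^+ a *: tensor_op site (fun j => pauli_mx R (w j)).
Proof.
apply: qop_eq => x y; rewrite entry_scale !entry_qop_of; congr (_ * _).
by apply: eq_bigr => j _; rewrite entry_pauli !ffunE.
Qed.

Lemma local_pauli_comm j p a w :
  local site j (pauli_mx R p) *m pauli_op R a w =
  (-1) ^+ pauli_anticommute p (w j) *:
    (pauli_op R a w *m local site j (pauli_mx R p)).
Proof.
rewrite pauli_op_tensor -scalemxAr -scalemxAl scalerA mulrC -scalerA.
congr (_ *: _).
rewrite !(tensor_mul site_bij); apply: qop_eq => x y.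
rewrite entry_scale !entry_tensor (bigD1 j)//= [in RHS](bigD1 j)//= eqxx.
rewrite pauli_mx_comm entry_scale mulrA; congr (_ * _).
by apply: eq_bigr => i /negPf ->; rewrite mulmx1 mul1mx.
Qed.

Lemma pauli_unitary A : pauli_group A -> A \is unitarymx.
Proof.
move=> [a [w ->]]; apply/unitarymxP; rewrite pauli_op_tensor linearZ /= map_mxZ.
rewrite -scalemxAl -scalemxAr scalerA rmorphXn -exprMn /=.
rewrite (_ : _ * _ = 1 :> C) ?expr1n ?scale1r; last first.
  by apply/eqP; rewrite eq_complex /=; apply/andP; split; apply/eqP; ring.
rewrite tensor_adj (tensor_mul site_bij) -(tensor_1 _ site_bij).
by apply: tensor_ext => j; rewrite pauli_mx_adj pauli_mx_sqr.
Qed.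

Lemma stabilizer_adj S A : is_stabilizer S -> S A -> S (A ^t*).
Proof.
move=> [SP S1 SM _ _] SA; rewrite -invmx_unitary; last exact/pauli_unitary/SP.
by have [] := SM _ _ SA S1.
Qed.

(** If some factor of A is not the identity, a Pauli matrix on that qubit anticommutes with A, and
    conjugation by it negates the trace. Otherwise A is a power of i; any but 1 equals -1 or has
    square -1, so it would put -1 into S. *)
Lemma stabilizer_trace0 S A : is_stabilizer S -> S A -> A != 1%:M -> \tr A = 0.
Proof.
move=> [SP S1 SM _ SN1] SA A1; have [a [w Aw]] := SP _ SA.
have [wI|/existsNP[j wj]] := pselect (forall j, w j = PauliI).
  have {}Aw : A = 'i%C ^+ a *: 1%:M.
    rewrite Aw pauli_op_tensor; congr (_ *: _); rewrite -(tensor_1 _ site_bij).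
    by apply: tensor_ext => j; rewrite wI pauli_mxI.
  have AA : A *m A = ('i%C ^+ 2) ^+ a *: 1%:M.
    by rewrite Aw -scalemxAl -scalemxAr scalerA mulmx1 -expr2 -exprM -exprM mulnC.
  exfalso; apply: SN1; move: AA; rewrite sqr_i -signr_odd.
  case: (boolP (odd a)) => [_ AA|ev _].
    by have [] := SM _ _ SA SA; rewrite AA expr1 scaleN1r.
  move: Aw A1 SA; rewrite -[a]odd_double_half (negPf ev) add0n -mul2n exprM sqr_i.
  rewrite -signr_odd; case: odd => -> /=; first by rewrite expr1 scaleN1r.
  by rewrite expr0 scale1r eqxx.
have [p pw] : exists p, pauli_anticommute p (w j) = true.
  by case: (w j) wj => // _; [exists PauliY|exists PauliX|exists PauliX].
pose B := local site j (pauli_mx R p).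
have BB : B *m B = 1%:M.
  by rewrite -(localM site_bij) pauli_mx_sqr (local_1 _ site_bij).
have BA : B *m A = - (A *m B).
  by rewrite Aw local_pauli_comm pw expr1 scaleN1r.
have : \tr A = - \tr A.
  rewrite -[in LHS](mulmx1 A) -BB mulmxA mxtrace_mulC mulmxA BA mulNmx.
  by rewrite -mulmxA BB mulmx1 linearN.
by move/eqP; rewrite -addr_eq0 -mulr2n mulrn_eq0 => /eqP.
Qed.

(** The projector is the average of S, which is invariant because multiplication by an element of S
    permutes S. Its trace is nonzero, since only the identity contributes. *)
Lemma stabilizer_projector_exists S : is_stabilizer S -> finite_set S ->
  exists P, is_orth_projector (Defs.code S) P /\ P != 0.
Proof.
move=> St /finite_seqP[s0 S0].
have [SP S1 SM Sc SN1] := St.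
pose s := undup s0.
have us : uniq s by apply: undup_uniq.
have sE A : (A \in s) <-> S A by rewrite S0 /= mem_undup.
have s_gt0 : (0 < size s)%N.
  by move: ((sE 1%:M).2 S1); case: (s).
have sz : (size s)%:R != 0 :> C by rewrite pnatr_eq0 -lt0n.
pose P := (size s)%:R^-1 *: \sum_(A <- s) A.
have sM A : S A -> perm_eq [seq A *m B | B <- s] s.
  move=> SA; have Au := unitarymx_unit (pauli_unitary (SP _ SA)).
  apply: uniq_perm => //.
    by rewrite map_inj_uniq// => B1 B2 /(congr1 (mulmx (invmx A))); rewrite !mulKmx.
  move=> B; apply/mapP/idP => [[B' /sE SB' ->]|/sE SB].
    by apply/sE; have [] := SM _ _ SA SB'.
  exists (invmx A *m B); last by rewrite mulKVmx.
  by apply/sE; have [_ SA'] := SM _ _ SA S1; have [] := SM _ _ SA' SB.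
have AP A : S A -> A *m P = P.
  move=> SA; rewrite -scalemxAr mulmx_sumr; congr (_ *: _).
  by rewrite -(big_map (mulmx A) predT id); apply: perm_big; apply: sM.
exists P; split; last first.
  apply/eqP => /(congr1 (@mxtrace _ _)); rewrite linear0 linearZ /= linear_sum /=.
  rewrite (bigD1_seq 1%:M)//=; last exact/sE.
  rewrite big1_seq ?addr0 => [|A /andP[A1 /sE SA]].
    2: exact: stabilizer_trace0 SA A1.
  move/eqP; rewrite mulf_eq0 invr_eq0 (negPf sz) /= mxtrace1 pnatr_eq0.
  by rewrite card_ffun card_bool expn_eq0.
split.
- rewrite {1}/P -scalemxAl mulmx_suml (eq_big_seq (fun=> P)) => [|A /sE]; last exact: AP.
  by rewrite big_const_seq count_predT iter_addr_0 -(scaler_nat _ P) scalerA mulVf// scale1r.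
- rewrite /P linearZ /= map_mxZ fmorphV rmorph_nat linear_sum /= raddf_sum.
  congr (_ *: _).
  rewrite -(big_map (fun A : qop R 'I_n => A ^t*) predT id); apply: perm_big.
  apply: uniq_perm => //.
    by rewrite map_inj_uniq// => A B AB; rewrite -[A]trmxCK AB trmxCK.
  move=> B; apply/mapP/idP => [[B' /sE SB' ->]|/sE SB].
    by apply/sE; apply: stabilizer_adj.
  by exists (B ^t*); rewrite ?trmxCK//; apply/sE; apply: stabilizer_adj.
- move=> v; split=> [cv|Pv A SA]; last by rewrite -Pv mulmxA AP.
  rewrite -scalemxAl mulmx_suml (eq_big_seq (fun=> v)) => [|A /sE]; last exact: cv.
  by rewrite big_const_seq count_predT iter_addr_0 -(scaler_nat _ v) scalerA mulVf// scale1r.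
Qed.

Section Projector.
Variable S : set (qop R 'I_n).
Hypotheses (St : is_stabilizer S) (Sfin : finite_set S).
Local Notation Q := (projector S).

Lemma projectorP : is_orth_projector (Defs.code S) Q.
Proof.
have [P [Pp _]] := stabilizer_projector_exists St Sfin.
exact: (xgetPex 0 (ex_intro _ P Pp)).
Qed.

Lemma projector_idem : Q *m Q = Q.
Proof. by have [] := projectorP. Qed.

Lemma projector_herm : Q ^t* = Q.
Proof. by have [] := projectorP. Qed.

Lemma col_mulmx m p r (A : 'M[C]_(m, p)) (B : 'M[C]_(p, r)) j :
  col j (A *m B) = A *m col j B.
Proof. by rewrite !colE mulmxA. Qed.

Lemma projector_fix (M : qop R 'I_n) :
  Q *m M = M <-> forall A, S A -> A *m M = M.
Proof.
have [_ _ QE] := projectorP; split=> [QM A SA|AM]; apply/matrixP => x y.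
  have /QE/(_ A SA)/colP/(_ x) : Q *m col y M = col y M by rewrite -col_mulmx QM.
  by rewrite -col_mulmx !mxE.
have /QE/colP/(_ x) : Defs.code S (col y M).
  by move=> A SA; rewrite -col_mulmx AM.
by rewrite -col_mulmx !mxE.
Qed.

Lemma stab_projector A : S A -> A *m Q = Q.
Proof. by move=> SA; apply: (projector_fix Q).1 SA; apply: projector_idem. Qed.

Lemma projector_stab A : S A -> Q *m A = Q.
Proof.
move=> SA; have /(congr1 (fun M => M ^t*)) := stab_projector (stabilizer_adj St SA).
by rewrite adj_mul projector_herm trmxCK.
Qed.

(** An operator commuting with S preserves the code, so Q B Q = B Q. The same for the adjoint of B
    gives Q B Q = Q B. *)
Lemma projector_comm B : (forall A, S A -> comm_mx B A) -> comm_mx B Q.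
Proof.
suff H B' : (forall A, S A -> comm_mx B' A) -> Q *m (B' *m Q) = B' *m Q.
  move=> BS; have BsS A : S A -> comm_mx (B ^t*) A.
    move=> SA; have := comm_mx_adj (BS _ (stabilizer_adj St SA)).
    by rewrite trmxCK.
  have := congr1 (fun M => M ^t*) (H _ BsS).
  by rewrite !adj_mul projector_herm trmxCK /comm_mx -(H _ BS) mulmxA => ->.
move=> BS; apply/projector_fix => A SA.
by rewrite mulmxA -(BS _ SA) -mulmxA (stab_projector SA).
Qed.

Lemma projector_neq0 : Q != 0.
Proof.
have [P [[PP _ PE] P0]] := stabilizer_projector_exists St Sfin.
apply: contraNneq P0 => Q0.
suff : Q *m P = P by rewrite Q0 mul0mx => <-.
apply/projector_fix => A SA; apply/matrixP => x y.
have /PE/(_ A SA)/colP/(_ x) : P *m col y P = col y P by rewrite -col_mulmx PP.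
by rewrite -col_mulmx !mxE.
Qed.

Hypothesis Snontriv : free_of_trivial_qubits S.

(* A single-qubit Pauli anticommuting with a stabilizer element is annihilated
   by the compression; one commuting with all of S is determined by the qubit
   up to the identity, since S acts nontrivially on that qubit. *)
Lemma site_compress_comm j j' D E :
  comm_mx (Q *m local site j D *m Q) (Q *m local site j' E *m Q).
Proof.
wlog : D E / exists p q, D = pauli_mx R p /\ E = pauli_mx R q.
  move=> H; have [c ->] := pauli_mx_span D; have [d ->] := pauli_mx_span E.
  rewrite !local_sum !mulmx_sumr !mulmx_suml.
  apply: comm_mx_sum => p _; apply: comm_mx_sym; apply: comm_mx_sum => q _.
  rewrite !localZ -!scalemxAr -!scalemxAl; apply: comm_mxZ.
  apply: comm_mx_sym; apply: comm_mxZ.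
  by apply: H; exists q, p.
move=> [p [q [-> ->]]] {D E}.
have dich i r : Q *m local site i (pauli_mx R r) *m Q = 0 \/
    (forall A, S A -> comm_mx (local site i (pauli_mx R r)) A) /\
    (forall a w, S (pauli_op R a w) -> pauli_anticommute r (w i) = false).
  have [SP _ _ _ _] := St.
  have [[a [w [Sw anti]]]|no] := pselect (exists a w, S (pauli_op R a w) /\
      pauli_anticommute r (w i) = true).
    left; have e := local_pauli_comm i r a w.
    apply: eq_opp_mx0; rewrite -[in X in _ *m X = _](stab_projector Sw).
    rewrite mulmxA -(mulmxA Q) e anti expr1 scaleN1r.
    by rewrite mulmxN mulmxA projector_stab// mulNmx.
  have nac a w : S (pauli_op R a w) -> pauli_anticommute r (w i) = false.
    by move=> Sw; apply/negP => ac; apply: no; exists a, w.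
  right; split=> // A SA; have [a [w Aw]] := SP _ SA; rewrite Aw in SA *.
  by rewrite /comm_mx local_pauli_comm (nac _ _ SA) scale1r.
have [->|[cp ap]] := dich j p; first by rewrite /comm_mx mulmx0 mul0mx.
have [->|[cq aq]] := dich j' q; first by rewrite /comm_mx mulmx0 mul0mx.
have pq : comm_mx (local site j (pauli_mx R p)) (local site j' (pauli_mx R q)).
  apply: (local_comm site_bij) => /eqP jj'; subst j'.
  have [a [w [Sw wj]]] := Snontriv j; move: (ap _ _ Sw) (aq _ _ Sw) wj.
  rewrite /comm_mx pauli_mx_comm.
  by case: p {cp ap} => //; case: q {cq aq} => //; case: (w j) => //=; rewrite scale1r.
have Qp := projector_comm cp; have Qq := projector_comm cq.
rewrite -Qp -Qq -!(mulmxA _ Q Q) projector_idem.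
apply: comm_mxM; apply: comm_mx_sym; apply: comm_mxM => //; exact: comm_mx_sym.
Qed.
End Projector.
End Stabilizer.

(** * Compressions to the code space *)

Lemma prod_bool (K : comNzRingType) (I : finType) (p : pred I) :
  \prod_i (p i)%:R = [forall i, p i]%:R :> K.
Proof.
case: forallP => [pT|/forallP]; first by apply: big1 => i _; rewrite pT.
by rewrite negb_forall => /existsP[i /negPf pF]; rewrite (bigD1 i)//= pF mul0r.
Qed.

Section Blocks.
Variables (R : realType) (n N : nat).
Local Notation C := R[i].

Definition in_block (b : 'I_N) (j : 'I_n) := (b, j).
Definition in_column (j : 'I_n) (b : 'I_N) := (b, j).

Lemma in_block_bij : bijective (fun p => in_block p.1 p.2).
Proof. by exists id => -[]. Qed.

Lemma in_column_bij : bijective (fun p => in_column p.1 p.2).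
Proof. by exists (fun p => (p.2, p.1)) => -[]. Qed.

Definition matrix_unit (T : finType) (u v : {ffun T -> bool}) : qop R T :=
  qop_of (fun x y => ((x == u) && (y == v))%:R).

Lemma matrix_unit_sum (T : finType) (D : qop R T) :
  D = \sum_u \sum_v entry D u v *: matrix_unit u v.
Proof.
have entry_sum (K : finType) (F : K -> qop R T) x y :
    entry (\sum_k F k) x y = \sum_k entry (F k) x y by rewrite /entry summxE.
apply: qop_eq => x y; rewrite entry_sum (bigD1 x)//= entry_sum (bigD1 y)//=.
rewrite entry_scale entry_qop_of !eqxx mulr1 !big1 ?addr0// => [u ux|v vy].
  rewrite entry_sum big1// => v _.
  by rewrite entry_scale entry_qop_of eq_sym (negPf ux) mulr0.
by rewrite entry_scale entry_qop_of eqxx /= eq_sym (negPf vy) mulr0.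
Qed.

(** Columns cut across blocks, but a matrix unit on a column factors into one-qubit operators, one
    per block. Compression by [block_projector] can then be evaluated block by block. *)
Lemma local_matrix_unit j (u v : {ffun 'I_N -> bool}) :
  local in_column j (matrix_unit u v) = tensor_op in_block (fun b =>
    local (site (n := n)) j (matrix_unit [ffun=> u b] [ffun=> v b])).
Proof.
apply: qop_eq => x y; rewrite entry_local entry_tensor entry_qop_of -natrM mulnb.
under eq_bigr do rewrite entry_local entry_qop_of -natrM mulnb.
rewrite prod_bool; congr (nat_of_bool _)%:R; apply/andP/forallP.
  move=> [/andP[/eqP/ffunP xu /eqP/ffunP yv] /forallP xy] b.
  apply/andP; split; first apply/andP; first split.
  - by apply/eqP/ffunP => -[]; rewrite !ffunE -xu ffunE.
  - by apply/eqP/ffunP => -[]; rewrite !ffunE -yv ffunE.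
  apply/forallP => i; apply/implyP => ij; have := xy i.
  rewrite ij /= => /eqP/ffunP/(_ b); rewrite !ffunE => e.
  by apply/eqP/ffunP => -[]; rewrite !ffunE.
move=> H; split; first apply/andP; first split.
- apply/eqP/ffunP => b; have /andP[/andP[/eqP/ffunP/(_ tt) + _] _] := H b.
  by rewrite !ffunE.
- apply/eqP/ffunP => b; have /andP[/andP[_ /eqP/ffunP/(_ tt) +] _] := H b.
  by rewrite !ffunE.
apply/forallP => i; apply/implyP => ij; apply/eqP/ffunP => b.
have /andP[_ /forallP/(_ i)] := H b; rewrite ij /= => /eqP/ffunP/(_ tt).
by rewrite !ffunE.
Qed.

Variable S : set (qop R 'I_n).
Hypotheses (St : is_stabilizer S) (Sfin : finite_set S).
Local Notation P := (block_projector S N).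

Lemma block_projector_idem : P *m P = P.
Proof.
rewrite (tensor_mul in_block_bij); apply: tensor_ext => b.
exact: projector_idem.
Qed.

Lemma block_projector_herm : P ^t* = P.
Proof. by rewrite tensor_adj; apply: tensor_ext => b; apply: projector_herm. Qed.

Lemma block_projector_neq0 : P != 0.
Proof.
have /eqP Q0 := projector_neq0 St Sfin.
have [x [y Qxy]] : exists x y, entry (projector S) x y != 0.
  apply: contrapT => h; apply: Q0; apply: qop_eq => x y.
  rewrite [RHS]mxE; apply/eqP/negPn/negP => xy; apply: h; by exists x, y.
(* Repeating [x] and [y] in every block picks out a power of a nonzero entry of [projector S]. *)
pose z (x : {ffun 'I_n -> bool}) : {ffun 'I_N * 'I_n -> bool} := [ffun p => x p.2].
have zE u b : restr (in_block b) (z u) = u by apply/ffunP => j; rewrite !ffunE.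
apply/eqP => P0; have : entry P (z x) (z y) = 0 by rewrite P0 /entry mxE.
rewrite entry_tensor => /eqP; rewrite prodf_seq_eq0 => /hasP[b _ /=].
by rewrite !zE (negPf Qxy).
Qed.

Lemma block_projector_local b D : comm_mx D (projector S) ->
  comm_mx (local in_block b D) P.
Proof.
move=> DQ; apply: (tensor_comm in_block_bij) => b'.
by case: eqP => // _; apply/comm_mx_sym/comm_mx1.
Qed.

Hypothesis Snontriv : free_of_trivial_qubits S.

(** After expansion in matrix units, each compressed term is a tensor product over blocks of
    one-qubit compressions, which commute by [site_compress_comm]. *)
Lemma column_compress_comm j j' (D E : qop R 'I_N) :
  comm_mx (P *m local in_column j D *m P) (P *m local in_column j' E *m P).
Proof.
rewrite (matrix_unit_sum D) (matrix_unit_sum E) !pair_bigA /= !local_sum.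
rewrite !mulmx_sumr !mulmx_suml.
apply: comm_mx_sum => q _; apply: comm_mx_sym; apply: comm_mx_sum => p _.
rewrite !localZ -!scalemxAr -!scalemxAl; apply: comm_mxZ.
apply: comm_mx_sym; apply: comm_mxZ.
rewrite !local_matrix_unit !(tensor_mul in_block_bij).
by apply: (tensor_comm in_block_bij) => b; apply: site_compress_comm.
Qed.

(** Only the whole sums are known to commute with P, not their summands. So H P is first written as
    P H P, and the summands are then compressed one at a time. *)
Lemma column_sum_compress_comm (D E : 'I_n -> qop R 'I_N) :
  let H := \sum_j local in_column j (D j) in
  let K := \sum_j local in_column j (E j) in
  comm_mx H P -> comm_mx K P -> comm_mx (H *m P) (K *m P).
Proof.
move=> H K HP KP.
have compress M : comm_mx M P -> M *m P = P *m M *m P.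
  by move=> MP; rewrite -MP -mulmxA block_projector_idem.
rewrite (compress _ HP) (compress _ KP) !mulmx_sumr !mulmx_suml.
apply: comm_mx_sum => q _; apply: comm_mx_sym; apply: comm_mx_sum => p _.
exact: column_compress_comm.
Qed.
End Blocks.

(** * Logarithms near the identity *)

Section Phase.
Variable R : realType.
Local Notation C := R[i].

Definition expi (t : R) : C := (cos t +i* sin t)%C.

(** An argument of [z] when [z] has modulus 1 and nonnegative real part. *)
Definition phase (z : C) : R := asin (complex.Im z).

Lemma expiD s t : expi (s + t) = expi s * expi t.
Proof.
rewrite /expi cosD sinD; apply/eqP; rewrite eq_complex /= eqxx /=.
by rewrite addrC (mulrC (sin s)) (mulrC (cos s) (sin t)) eqxx.
Qed.

Lemma expi_sum (I : finType) (t : I -> R) :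
  expi (\sum_i t i) = \prod_i expi (t i).
Proof. by apply: (big_morph _ expiD); rewrite /expi cos0 sin0. Qed.

(** Since sin eta is at most 1, the real part of [z] is nonnegative and [asin] recovers the
    argument. The bound on it follows from that on the imaginary part, as sin increases on
    [-pi/2, pi/2]. *)
Lemma small_phase z eta : 0 < eta <= pi / 2 ->
  `|z| = 1 -> `|z - 1| < (sin eta)%:C%C -> expi (phase z) = z /\ `|phase z| < eta.
Proof.
move=> /andP[eta0 eta_le]; rewrite !normc_def ltcR /=.
case: z => x y /= /(@complexI R) xy1 z1.
have {xy1} xy1 : x ^+ 2 + y ^+ 2 = 1.
  by rewrite -[LHS]sqr_sqrtr ?xy1 ?expr1n// addr_ge0// sqr_ge0.
have se1 : sin eta <= 1 by apply: sin_le1.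
have xlt : `|x - 1| < sin eta.
  apply: le_lt_trans z1; rewrite -sqrtr_sqr ler_wsqrtr// lerDl; exact: sqr_ge0.
have ylt : `|y| < sin eta.
  apply: le_lt_trans z1; rewrite -sqrtr_sqr ler_wsqrtr// oppr0 addr0 lerDr; exact: sqr_ge0.
have x0 : 0 <= x.
  by move: xlt; rewrite ltr_norml => /andP[+ _]; lra.
have y1 : -1 <= y <= 1.
  by move: ylt; rewrite ltr_norml => /andP[]; lra.
rewrite /phase /=; split.
  rewrite /expi cos_asin// asinK ?in_itv//; congr (_ +i* _)%C.
  by rewrite -xy1 addrK sqrtr_sqr ger0_norm.
have pi2 : 0 <= (pi / 2 : R) by rewrite divr_ge0 ?pi_ge0.
have etaI : eta \in `[(- (pi / 2)), (pi / 2)].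
  by rewrite in_itv/= eta_le andbT; lra.
have etaN : - eta \in `[(- (pi / 2)), (pi / 2)].
  by rewrite in_itv/=; apply/andP; split; lra.
have phI : asin y \in `[(- (pi / 2)), (pi / 2)].
  by rewrite in_itv/= asin_geNpi2// asin_lepi2.
move: ylt; rewrite !ltr_norml => /andP[yl yu].
by rewrite -(ltr_sin etaN phI) -(ltr_sin phI etaI) sinN asinK ?in_itv// yl.
Qed.

(** Phases this small have their sum in [-pi/2, pi/2], where the sine alone, hence the product of
    the numbers, determines it. *)
Lemma phase_prod n : exists2 eps : R, 0 < eps &
  forall l m : 'I_n -> C,
    (forall j, `|l j| = 1 /\ `|l j - 1| < eps%:C%C) ->
    (forall j, `|m j| = 1 /\ `|m j - 1| < eps%:C%C) ->
  \prod_j l j = \prod_j m j <-> \sum_j phase (l j) = \sum_j phase (m j).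
Proof.
(* This keeps the sum of [n] phases within pi / 2; the successor avoids division by 0. *)
pose eta : R := pi / 2 / n.+1%:R.
have pi2 : 0 < (pi / 2 : R) by rewrite divr_gt0 ?pi_gt0.
have n0 : 0 < n.+1%:R :> R by rewrite ltr0n.
have eta0 : 0 < eta by rewrite divr_gt0.
have eta_le : eta <= pi / 2 by rewrite ler_pdivrMr// ler_peMr ?ler1n// ltW.
exists (sin eta).
  apply: sin_gt0_pi; rewrite eta0 (le_lt_trans eta_le)//.
  by rewrite [ltRHS]splitr ltrDl.
have key (l : 'I_n -> C) :
    (forall j, `|l j| = 1 /\ `|l j - 1| < (sin eta)%:C%C) ->
    \prod_j l j = expi (\sum_j phase (l j)) /\
    \sum_j phase (l j) \in `[(- (pi / 2)), (pi / 2)].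
  move=> lP; have sP j : expi (phase (l j)) = l j /\ `|phase (l j)| < eta.
    by have [? ?] := lP j; apply: small_phase => //; rewrite eta0.
  split; first by rewrite expi_sum; apply: eq_bigr => j _; have [-> _] := sP j.
  rewrite in_itv /= -ler_norml (le_trans (ler_norm_sum _ _ _))//.
  apply: (@le_trans _ _ (\sum_(j < n) eta)).
    by apply: ler_sum => j _; have [_ /ltW] := sP j.
  rewrite sumr_const card_ord -[leLHS]mulr_natr /eta -mulrA ler_piMr ?ltW//.
  by rewrite mulrC ltr_pdivrMr// mul1r ltr_nat.
move=> l m /key[-> ls] /key[-> ms]; split=> [[_ sE]|-> //].
exact: sin_inj sE.
Qed.
End Phase.

Section UnitaryEntries.
Variables (R : realType) (m : nat).
Local Notation C := R[i].

Lemma unitary_entry_le1 (U : 'M[C]_m) i k : U \is unitarymx -> `|U i k| <= 1.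
Proof.
move=> /unitarymxP /matrixP/(_ i i); rewrite !mxE eqxx mulr1n => e.
rewrite -(@expr_le1 _ 2)// -e (bigD1 k)//= !mxE -normCK lerDl.
by apply: sumr_ge0 => l _; rewrite !mxE -normCK exprn_ge0.
Qed.

(** Entries of a unitary have modulus at most 1, so each of the [m * m] terms is at most [e]. With a
    diagonalising unitary this bounds the distance of eigenvalues from 1. *)
Lemma conj_unitary_entry (U A : 'M[C]_m) (e : C) i : U \is unitarymx ->
  (forall k l, `|A k l| <= e) -> `|(U *m A *m U ^t*) i i| <= e *+ m *+ m.
Proof.
move=> Uu Ae; rewrite mxE (le_trans (ler_norm_sum _ _ _))//.
have -> : e *+ m *+ m = \sum_(k < m) \sum_(l < m) e by rewrite !sumr_const !card_ord.
apply: ler_sum => k _; rewrite mxE normrM !mxE norm_conjC.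
apply: (@le_trans _ _ `|\sum_j U i j * A j k|).
  by rewrite ler_piMr// unitary_entry_le1.
rewrite (le_trans (ler_norm_sum _ _ _))//; apply: ler_sum => l _.
by rewrite normrM -[leRHS]mul1r ler_pM// unitary_entry_le1.
Qed.

(** Eigenbasis and eigenvalues form one pair, so that a single [choice] selects them for all
    columns. *)
Lemma unitary_spectrum (U : 'M[C]_m) : U \is unitarymx ->
  exists Vd : 'M[C]_m * 'rV[C]_m,
    [/\ Vd.1 \is unitarymx, U = Vd.1 ^t* *m diag_mx Vd.2 *m Vd.1,
        diag_mx Vd.2 = Vd.1 *m U *m Vd.1 ^t* & forall i, `|Vd.2 0 i| = 1].
Proof.
move=> Uu; have : U \is normalmx.
  by apply/normalmxP; rewrite unitary_adjl//; apply/unitarymxP.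
move=> /orthomx_spectralP; set V := spectralmx U; set d := spectral_diag U.
have Vu : V \is unitarymx := spectral_unitarymx U.
rewrite invmx_unitary// => Ud.
have dU : diag_mx d = V *m U *m V ^t*.
  by rewrite Ud !mulmxA (unitarymxP Vu) mul1mx -mulmxA (unitarymxP Vu) mulmx1.
exists (V, d); split=> //= i; apply/eqP.
rewrite -(@eqrXn2 _ 2)// expr1n normCK.
have : diag_mx d \is unitarymx by rewrite dU !mul_unitarymx// trmxC_unitary.
move=> /unitarymxP/matrixP/(_ i i); rewrite tr_diag_mx map_diag_mx mulmx_diag.
by rewrite !mxE eqxx !mulr1n => ->.
Qed.

End UnitaryEntries.

(** * Diagonal operators and logarithms of transversal gates *)

Section Diagonal.
Variable R : realType.
Local Notation C := R[i].
Implicit Types T I J : finType.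

Definition qdiag T (f : {ffun T -> bool} -> C) : qop R T :=
  qop_of (fun x y => f x * (x == y)%:R).

Lemma diag_mx_qdiag T (d : 'rV[C]_#|{ffun T -> bool}|) :
  diag_mx d = qdiag (fun x => d 0 (enum_rank x)).
Proof.
apply: qop_eq => x y.
by rewrite entry_qop_of /entry !mxE (inj_eq enum_rank_inj) mulr_natr.
Qed.

Lemma tensor_qdiag T I J (pos : I -> J -> T) f :
  bijective (fun p => pos p.1 p.2) ->
  tensor_op pos (fun i => qdiag (f i)) =
  qdiag (fun x => \prod_i f i (restr (pos i) x)).
Proof.
move=> posP; apply: qop_eq => x y; rewrite entry_tensor entry_qop_of.
rewrite (restr_all_eq posP) -prod_bool -big_split /=.
by apply: eq_bigr => i _; rewrite entry_qop_of.
Qed.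

Lemma local_qdiag T I J (pos : I -> J -> T) i f :
  bijective (fun p => pos p.1 p.2) ->
  local pos i (qdiag f) = qdiag (fun x => f (restr (pos i) x)).
Proof.
move=> posP; apply: qop_eq => x y; rewrite entry_local !entry_qop_of.
rewrite (restr_all_eq posP) -mulrA -natrM mulnb; congr (_ * (nat_of_bool _)%:R).
apply/andP/forallP => [[ii /forallP H] i'|H].
  by have := H i'; case: eqP => [->|].
by split=> //; apply/forallP => i'; apply/implyP.
Qed.

(** Commuting with a diagonal operator means having zero entries between states of different
    eigenvalue, and states separated by [g] are separated by [f]. *)
Lemma qdiag_comm T (f g : {ffun T -> bool} -> C) B :
  (forall x y, f x = f y -> g x = g y) ->
  comm_mx (qdiag f) B -> comm_mx (qdiag g) B.
Proof.
move=> fg.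
have L h x y : entry (qdiag h *m B) x y = h x * entry B x y.
  rewrite entry_mul (bigD1 x)//= entry_qop_of eqxx mulr1 big1 ?addr0// => z zx.
  by rewrite entry_qop_of eq_sym (negPf zx) mulr0 mul0r.
have Rr h x y : entry (B *m qdiag h) x y = h y * entry B x y.
  rewrite entry_mul (bigD1 y)//= entry_qop_of eqxx mulr1 big1 ?addr0 1?mulrC// => z zy.
  by rewrite entry_qop_of (negPf zy) !mulr0.
move=> fB; apply: qop_eq => x y; rewrite L Rr.
have : f x * entry B x y = f y * entry B x y by rewrite -L -Rr fB.
by have [->|B0] := eqVneq (entry B x y) 0; rewrite ?mulr0// => /(mulIf B0)/fg ->.
Qed.

Lemma comm_mx_conj m (U A B : 'M[C]_m) : U \is unitarymx ->
  comm_mx (U ^t* *m A *m U) B <-> comm_mx A (U *m B *m U ^t*).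
Proof.
move=> Uu; have UU := unitarymxP Uu; have UsU := unitary_adjl Uu.
rewrite /comm_mx; split=> AB.
  have := congr1 (fun M => U *m M *m U ^t*) AB.
  by rewrite !mulmxA UU mul1mx -!mulmxA UU mulmx1 !mulmxA.
have := congr1 (fun M => U ^t* *m M *m U) AB.
by rewrite !mulmxA UsU mul1mx -!mulmxA UsU mulmx1 !mulmxA.
Qed.

(* [phase_prod] makes the eigenspaces of the product of the [W j] coincide with
   those of the sum of their logarithms. *)
Lemma transversal_log n N : exists2 eps : R, 0 < eps &
  forall W : 'I_n -> qop R 'I_N, (forall j, W j \is unitarymx) ->
    (forall j k l, `|(W j - 1%:M) k l| <= eps%:C%C) ->
  exists D : 'I_n -> qop R 'I_N, forall B,
    comm_mx (tensor_op (@in_column n N) W) B <->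
    comm_mx (\sum_j local (@in_column n N) j (D j)) B.
Proof.
have [eps eps0 epsP] := phase_prod R n.
pose m := #|{ffun 'I_N -> bool}|.
have m0 : 0 < (m * m).+1%:R :> R by rewrite ltr0n.
exists (eps / (m * m).+1%:R); first by rewrite divr_gt0.
move=> W Wu W1.
have [Vd VdP] := choice (fun j => unitary_spectrum (Wu j)).
pose V j := (Vd j).1; pose d j := (Vd j).2.
have Vu j : V j \is unitarymx by have [] := VdP j.
have dP j : [/\ W j = (V j) ^t* *m diag_mx (d j) *m V j,
    diag_mx (d j) = V j *m W j *m (V j) ^t* & forall i, `|d j 0 i| = 1].
  by have [] := VdP j.
have d1 j i : `|d j 0 i| = 1 /\ `|d j 0 i - 1| < eps%:C%C.
  have [Wj dj nj] := dP j; split; first exact: nj.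
  have -> : d j 0 i - 1 = (V j *m (W j - 1%:M) *m (V j) ^t*) i i.
    rewrite mulmxBr mulmxBl -dj mulmx1 (unitarymxP (Vu j)) !mxE eqxx.
    by rewrite mulr1n.
  apply: le_lt_trans (conj_unitary_entry i (Vu j) (W1 j)) _.
  rewrite -!mulrnA -rmorphMn /= ltcR -mulr_natr mulrAC.
  by rewrite ltr_pdivrMr// ltr_pM2l// ltr_nat.
(* The generator for column [j] keeps the eigenvectors of [W j] and replaces each eigenvalue by its
   phase. *)
pose th j x : C := (phase (d j 0 (enum_rank x)))%:C%C.
exists (fun j => (V j) ^t* *m qdiag (th j) *m V j) => B.
pose VV := tensor_op (@in_column n N) V.
have pB := @in_column_bij n N.
have VVu : VV \is unitarymx by apply: tensor_unitary.
have -> : \sum_j local (@in_column n N) j ((V j) ^t* *m qdiag (th j) *m V j) =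
    VV ^t* *m qdiag (fun x => \sum_j th j (restr (in_column j) x)) *m VV.
  have -> : qdiag (fun x => \sum_j th j (restr (in_column j) x)) =
      \sum_j local (@in_column n N) j (qdiag (th j)).
    under [RHS]eq_bigr do rewrite local_qdiag//.
    apply: qop_eq => x y; rewrite entry_qop_of /entry summxE mulr_suml.
    by apply: eq_bigr => j _; rewrite -/(entry _ _ _) entry_qop_of.
  rewrite mulmx_sumr mulmx_suml; apply: eq_bigr => j _.
  by rewrite /VV tensor_adj tensor_local_conj.
have -> : tensor_op (@in_column n N) W = VV ^t* *m
    qdiag (fun x => \prod_j d j 0 (enum_rank (restr (in_column j) x))) *m VV.
  rewrite -(tensor_qdiag (fun j x => d j 0 (enum_rank x)) pB).
  rewrite tensor_adj !(tensor_mul pB); apply: tensor_ext => j.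
  rewrite -(diag_mx_qdiag (d j)); by have [] := dP j.
(* Two basis states have equal products of eigenvalues exactly when they have equal sums of phases,
   so [qdiag_comm] applies in both directions. *)
have E x y := epsP (fun j => d j 0 (enum_rank (restr (in_column j) x)))
  (fun j => d j 0 (enum_rank (restr (in_column j) y))) (fun j => d1 j _)
  (fun j => d1 j _).
rewrite !comm_mx_conj//; split; apply: qdiag_comm => x y.
  by move=> /E e; rewrite /th -!rmorph_sum e.
by rewrite /th -!rmorph_sum => /complexI/E.
Qed.

End Diagonal.

(** * Pigeonhole principle and commutation near the identity *)

Section ComplexNorm.
Variable R : realType.
Implicit Type z : R[i].

Lemma normc_ge_Im z : `|complex.Im z|%:C%C <= `|z|.
Proof.
have i1 : `|'i%C : R[i]| = 1 by rewrite normc_def /= expr0n expr1n add0r sqrtr1.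
rewrite -[leRHS]mulr1 -i1 -normrM (le_trans _ (normc_ge_Re _))//.
by rewrite ReiNIm normrN.
Qed.

Lemma normc_le_ReIm z :
  `|z| <= (`|complex.Re z| + `|complex.Im z|)%:C%C.
Proof.
have i1 : `|'i%C : R[i]| = 1 by rewrite normc_def /= expr0n expr1n add0r sqrtr1.
have nR (x : R) : `|x%:C%C| = `|x|%:C%C.
  by rewrite normc_def /= expr0n addr0 sqrtr_sqr.
rewrite [z in leLHS]complexE (le_trans (ler_normD _ _))// normrM i1 mul1r !nR.
by rewrite -rmorphD.
Qed.
End ComplexNorm.

Section NearIdentity.
Variables (R : realType) (n N : nat).
Local Notation C := R[i].
Local Notation column := (@in_column n N).

(** Real and imaginary parts lie in [-1, 1], which is cut into cells. There are more families than
    assignments of cells, so two families share all cells. *)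
Lemma grid_pigeonhole (I : finType) (delta : R) : 0 < delta ->
  exists M, forall f : 'I_M.+1 -> I -> C, (forall a i, `|f a i| <= 1) ->
  exists a b, a != b /\ forall i, `|f a i - f b i| <= delta%:C%C.
Proof.
(* Cells have length 1 / K with 2 / K < delta, because the errors of the real and imaginary parts
   add up. *)
move=> delta0; pose K := (Num.truncn (2 / delta)).+1.
have K0 : 0 < K%:R :> R by rewrite ltr0n.
have Kd : 2 / K%:R < delta.
  rewrite ltr_pdivrMr// mulrC -ltr_pdivrMr//.
  exact: Num.Theory.truncnS_gt.
(* The last of the 2 K + 1 cells is there for x = 1. *)
pose cell (x : R) : 'I_(2 * K).+1 := inord (Num.truncn ((x + 1) * K%:R)).
have cellP (x y : R) : `|x| <= 1 -> `|y| <= 1 -> cell x = cell y -> `|x - y| < K%:R^-1.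
  have bnd (z : R) : `|z| <= 1 -> [/\ 0 <= (z + 1) * K%:R &
      (Num.truncn ((z + 1) * K%:R) < (2 * K).+1)%N].
    rewrite ler_norml => /andP[z1 z2].
    have z0 : 0 <= (z + 1) * K%:R by rewrite mulr_ge0 ?(ltW K0)//; lra.
    split=> //; rewrite ltnS -(ler_nat R) natrM.
    apply: le_trans (_ : (z + 1) * K%:R <= _); first by rewrite Num.Theory.truncn_le.
    by rewrite ler_pM2r//; lra.
  move=> /bnd[x0 xK] /bnd[y0 yK] /(congr1 val); rewrite /= !inordK// => e.
  have := Num.Theory.truncn_itv x0; have := Num.Theory.truncn_itv y0.
  rewrite e -natr1 => /andP[yl yu] /andP[xl xu].
  rewrite -(ltr_pM2r K0) mulVf ?gt_eqF// -{1}(gtr0_norm K0) -normrM.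
  rewrite ltr_norml mulrBl. apply/andP; split; nra.
pose M := #|{ffun I -> 'I_(2 * K).+1 * 'I_(2 * K).+1}|; exists M => f f1.
pose code a : {ffun I -> 'I_(2 * K).+1 * 'I_(2 * K).+1} :=
  [ffun i => (cell (complex.Re (f a i)), cell (complex.Im (f a i)))].
have /injectivePn[a [b ab cab]] : ~~ injectiveb code.
  apply/negP => /injectiveP/leq_card; by rewrite card_ord -/M ltnn.
exists a, b; split=> // i; move/ffunP: cab => /(_ i); rewrite !ffunE => -[].
have re_le (z : C) : `|z| <= 1 -> `|complex.Re z| <= 1 /\ `|complex.Im z| <= 1.
  move=> z1; rewrite -!(@lecR R).
  by rewrite (le_trans (normc_ge_Re z))// (le_trans (normc_ge_Im z)).
have [ra ia] := re_le _ (f1 a i); have [rb ib] := re_le _ (f1 b i).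
move=> /(cellP _ _ ra rb) r1 /(cellP _ _ ia ib) i1.
apply: le_trans (normc_le_ReIm _) _; rewrite lecR !raddfB /=.
apply: le_trans (ltW Kd); rewrite mulr_natl mulr2n; apply/ltW/ltrD => //.
Qed.

Section Commutation.
Variable S : set (qop R 'I_n).
Hypotheses (St : is_stabilizer S) (Sfin : finite_set S).
Hypothesis Snontriv : free_of_trivial_qubits S.
Local Notation P := (block_projector S N).

(** By [transversal_log] a gate and its generator have the same commutant, so gates replace
    generators one at a time: H commutes with H' P, hence T does; then H' commutes with T P, hence
    T' does. *)
Lemma near_identity_comm : exists2 eps : R, 0 < eps &
  forall W W' : 'I_n -> qop R 'I_N,
    (forall j, W j \is unitarymx) -> (forall j, W' j \is unitarymx) ->
    (forall j k l, `|(W j - 1%:M) k l| <= eps%:C%C) ->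
    (forall j k l, `|(W' j - 1%:M) k l| <= eps%:C%C) ->
    comm_mx (tensor_op column W) P -> comm_mx (tensor_op column W') P ->
  comm_mx (tensor_op column W *m P) (tensor_op column W' *m P).
Proof.
have [eps eps0 epsP] := transversal_log R n N; exists eps => // W W' Wu W'u W1 W'1 WP W'P.
have [D DW] := epsP W Wu W1; have [D' D'W] := epsP W' W'u W'1.
set T := tensor_op column W in DW WP *.
set T' := tensor_op column W' in D'W W'P *.
set H := \sum_j local column j (D j) in DW.
set H' := \sum_j local column j (D' j) in D'W.
have PP : P *m P = P := block_projector_idem N St Sfin.
have HP : comm_mx H P by apply/DW.
have H'P : comm_mx H' P by apply/D'W.
have HH' := column_sum_compress_comm St Sfin Snontriv HP H'P.
have /DW TH' : comm_mx H (H' *m P).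
  have e : H *m P *m (H' *m P) = H *m (H' *m P).
    by rewrite -mulmxA (mulmxA P) -H'P -!mulmxA PP.
  have e' : H' *m P *m (H *m P) = H' *m P *m H.
    by rewrite HP mulmxA -(mulmxA H') PP.
  by rewrite /comm_mx -e HH' e'.
have /D'W T'T : comm_mx H' (T *m P).
  by rewrite /comm_mx -[RHS]mulmxA -H'P TH' -mulmxA -WP.
by apply: comm_mxM; apply: comm_mx_sym => //; apply: comm_mxM.
Qed.

(** [M] is fixed before the gates, so the precision of approximations may depend on it. Two close
    gates have a quotient near the identity, and each product in the conclusion is such a quotient
    restricted to the code space. *)
Lemma transversal_pigeonhole : exists M,
  forall V V' : 'I_M.+1 -> 'I_n -> qop R 'I_N,
    (forall a j, V a j \is unitarymx) -> (forall a j, V' a j \is unitarymx) ->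
    (forall a, comm_mx (tensor_op column (V a)) P) ->
    (forall a, comm_mx (tensor_op column (V' a)) P) ->
  exists a b c d, [/\ a != b, c != d &
    comm_mx
     (tensor_op column (V a) *m P *m (tensor_op column (V b) *m P) ^t*)
     (tensor_op column (V' c) *m P *m (tensor_op column (V' d) *m P) ^t*)].
Proof.
have [eps eps0 epsP] := near_identity_comm.
pose m := #|{ffun 'I_N -> bool}|.
have m0 : 0 < m.+1%:R :> R by rewrite ltr0n.
(* The entries of all columns are compared at once. Each entry of a quotient minus 1 sums [m] terms,
   hence the division. *)
have [M MP] := @grid_pigeonhole ('I_n * 'I_m * 'I_m)%type _ (divr_gt0 eps0 m0).
exists M => V V' Vu V'u VP V'P.
have near (U : 'I_M.+1 -> 'I_n -> qop R 'I_N) : (forall a j, U a j \is unitarymx) ->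
    exists a b, a != b /\
      forall j k l, `|(U a j *m (U b j) ^t* - 1%:M) k l| <= eps%:C%C.
  move=> Uu; have [|a [b [ab UP]]] := MP (fun a p => U a p.1.1 p.1.2 p.2).
    by move=> a p; apply: unitary_entry_le1.
  exists a, b; split=> // j k l; rewrite -(unitarymxP (Uu b j)) -mulmxBl mxE.
  rewrite (le_trans (ler_norm_sum _ _ _))//.
  apply: (@le_trans _ _ (\sum_(i < m) (eps / m.+1%:R)%:C%C)).
    apply: ler_sum => i _; rewrite normrM -[leRHS]mulr1 ler_pM//.
      by have := UP (j, k, i); rewrite !mxE.
    by rewrite !mxE norm_conjC unitary_entry_le1.
  rewrite sumr_const card_ord -rmorphMn /= lecR -mulr_natr mulrAC.
  by rewrite ler_pdivrMr// ler_pM2l// ler_nat.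
have [a [b [ab abP]]] := near V Vu; have [c [d [cd cdP]]] := near V' V'u.
exists a, b, c, d; split=> //.
have PP : P *m P = P := block_projector_idem N St Sfin.
have quo (U : 'I_M.+1 -> 'I_n -> qop R 'I_N) a' b' :
    (forall a, comm_mx (tensor_op column (U a)) P) ->
    let W := tensor_op column (fun j => U a' j *m (U b' j) ^t*) in
    comm_mx W P /\
    tensor_op column (U a') *m P *m (tensor_op column (U b') *m P) ^t* = W *m P.
  move=> UP W.
  have UbP : comm_mx ((tensor_op column (U b')) ^t*) P.
    by have := comm_mx_adj (UP b'); rewrite block_projector_herm.
  have -> : W = tensor_op column (U a') *m (tensor_op column (U b')) ^t*.
    by rewrite tensor_adj (tensor_mul (@in_column_bij n N)).
  split; first by apply: comm_mx_sym; apply: comm_mxM; apply: comm_mx_sym.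
  rewrite adj_mul block_projector_herm// -[X in _ = X]mulmxA UbP.
  by rewrite !mulmxA -(mulmxA _ P P) PP.
have [abC ->] := quo V a b VP; have [cdC ->] := quo V' c d V'P.
by apply: epsP => // j; rewrite mul_unitarymx// trmxC_unitary.
Qed.
End Commutation.
End NearIdentity.

(** * The entrywise l1 norm *)

Section L1Norm.
Variables (R : realType).
Local Notation C := R[i].
Local Notation normc := (@Normc.normc R).

(** A substitute for [opnorm] that is submultiplicative and invariant under adjoints;
    [l1norm_opnorm] compares the two. *)
Definition l1norm m p (A : 'M[C]_(m, p)) : R := \sum_i \sum_j normc (A i j).

Lemma normcR (z : C) : `|z| = (normc z)%:C%C.
Proof. by rewrite normc_def; case: z. Qed.

Lemma normc_ge0 (z : C) : 0 <= normc z.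
Proof. by rewrite -lecR -normcR; apply: normr_ge0. Qed.

Lemma l1norm_ge0 m p (A : 'M[C]_(m, p)) : 0 <= l1norm A.
Proof. by apply: sumr_ge0 => i _; apply: sumr_ge0 => j _; apply: normc_ge0. Qed.

Lemma l1norm_entry m p (A : 'M[C]_(m, p)) i j : normc (A i j) <= l1norm A.
Proof.
rewrite /l1norm (bigD1 i)//= (bigD1 j)//= -addrA lerDl addr_ge0//.
  by apply: sumr_ge0 => k _; apply: normc_ge0.
by apply: sumr_ge0 => k _; apply: sumr_ge0 => l _; apply: normc_ge0.
Qed.

Lemma l1norm_eq0 m p (A : 'M[C]_(m, p)) : l1norm A = 0 -> A = 0.
Proof.
move=> A0; apply/matrixP => i j; rewrite mxE; apply: Normc.eq0_normc.
by apply/eqP; rewrite eq_le normc_ge0 -A0 l1norm_entry.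
Qed.

Lemma l1normD m p (A B : 'M[C]_(m, p)) : l1norm (A + B) <= l1norm A + l1norm B.
Proof.
rewrite /l1norm -big_split; apply: ler_sum => i _; rewrite -big_split.
by apply: ler_sum => j _; rewrite mxE; apply: le_normcD.
Qed.

Lemma l1normZ m p a (A : 'M[C]_(m, p)) : l1norm (a *: A) = normc a * l1norm A.
Proof.
rewrite /l1norm mulr_sumr; apply: eq_bigr => i _; rewrite mulr_sumr.
by apply: eq_bigr => j _; rewrite mxE Normc.normcM.
Qed.

Lemma l1normB m p (A B : 'M[C]_(m, p)) : l1norm (A - B) <= l1norm A + l1norm B.
Proof.
by rewrite -scaleN1r (le_trans (l1normD _ _))// l1normZ normcN Normc.normc1 mul1r.
Qed.

Lemma normc_sum (I : finType) (f : I -> C) :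
  normc (\sum_i f i) <= \sum_i normc (f i).
Proof.
elim/big_ind2: _ => [|x a y b ax yb|//]; first by rewrite Normc.normc0.
by rewrite (le_trans (le_normcD _ _))// lerD.
Qed.

Lemma l1normM m p r (A : 'M[C]_(m, p)) (B : 'M[C]_(p, r)) :
  l1norm (A *m B) <= l1norm A * l1norm B.
Proof.
rewrite {1 2}/l1norm mulr_suml; apply: ler_sum => i _.
apply: (@le_trans _ _ (\sum_k \sum_j normc (A i j) * normc (B j k))).
  apply: ler_sum => k _; rewrite mxE (le_trans (normc_sum _))//.
  by apply: ler_sum => j _; rewrite Normc.normcM.
rewrite exchange_big /= mulr_suml; apply: ler_sum => j _.
rewrite -mulr_sumr ler_wpM2l ?normc_ge0// /l1norm (bigD1 j)//= lerDl.
by apply: sumr_ge0 => l _; apply: sumr_ge0 => k _; apply: normc_ge0.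
Qed.

Lemma l1norm_adj m (A : 'M[C]_m) : l1norm (A ^t*) = l1norm A.
Proof.
rewrite /l1norm exchange_big; apply: eq_bigr => i _; apply: eq_bigr => j _.
by apply: (@complexI R); rewrite -!normcR !mxE norm_conjC.
Qed.

Lemma l1norm_unitary m (U : 'M[C]_m) : U \is unitarymx -> l1norm U <= (m * m)%:R.
Proof.
move=> Uu; have -> : (m * m)%:R = \sum_(i < m) \sum_(j < m) (1 : R).
  by rewrite !sumr_const !card_ord -mulrnA.
by apply: ler_sum => i _; apply: ler_sum => j _; rewrite -lecR -normcR unitary_entry_le1.
Qed.

Lemma l1norm_mulB m (A A' B B' : 'M[C]_m) (K e L f : R) :
  l1norm A <= K -> l1norm B' <= L -> l1norm (A - A') <= e -> l1norm (B - B') <= f ->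
  l1norm (A *m B - A' *m B') <= K * f + e * L.
Proof.
move=> AK BL Ae Bf.
have -> : A *m B - A' *m B' = A *m (B - B') + (A - A') *m B'.
  by rewrite mulmxBr mulmxBl addrA subrK.
rewrite (le_trans (l1normD _ _))// lerD// (le_trans (l1normM _ _))//;
  by rewrite ler_pM// l1norm_ge0.
Qed.

(** A crude bound, meant only to show that the set defining [opnorm] is bounded, so that its [sup]
    is an upper bound. *)
Lemma norm2_l1norm m (v : 'cV[C]_m) : norm2 v <= 1 + m%:R * l1norm v ^+ 2.
Proof.
have le1 (s : R) : s <= 1 + s ^+ 2 by nra.
apply: le_trans (le1 _) _; rewrite lerD2l sqr_sqrtr; last first.
  by apply: sumr_ge0 => i _; rewrite addr_ge0 ?sqr_ge0.
rewrite mulr_natl -[X in _ *+ X]card_ord -sumr_const; apply: ler_sum => i _.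
have -> : complex.Re (v i 0) ^+ 2 + complex.Im (v i 0) ^+ 2 = normc (v i 0) ^+ 2.
  by case: (v i 0) => a b /=; rewrite sqr_sqrtr// addr_ge0 ?sqr_ge0.
by rewrite ler_pXn2r ?nnegrE ?normc_ge0 ?l1norm_ge0// l1norm_entry.
Qed.

Lemma normc_le_norm2 m (v : 'cV[C]_m) i : normc (v i 0) <= norm2 v.
Proof.
rewrite /norm2 (bigD1 i)//=; case: (v i 0) => a b /=; rewrite ler_wsqrtr// lerDl.
by apply: sumr_ge0 => k _; rewrite addr_ge0 ?sqr_ge0.
Qed.

(** Every entry is a coordinate of the image of a basis vector, hence at most [opnorm A] in
    modulus. *)
Lemma l1norm_opnorm m (A : 'M[C]_m) : l1norm A <= (m * m)%:R * opnorm A.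
Proof.
have ub : has_ubound [set norm2 (A *m v) | v in [set v : 'cV[C]_m | norm2 v <= 1]].
  exists (1 + m%:R * (l1norm A * m%:R) ^+ 2) => _ /= [v v1 <-].
  apply: le_trans (norm2_l1norm _) _; rewrite lerD2l ler_wpM2l//.
  rewrite ler_pXn2r ?nnegrE ?l1norm_ge0 ?mulr_ge0 ?l1norm_ge0//.
  apply: le_trans (l1normM _ _) _; rewrite ler_wpM2l ?l1norm_ge0//.
  have -> : m%:R = \sum_(i < m) (1 : R) by rewrite sumr_const card_ord.
  apply: ler_sum => i _.
  by rewrite big_ord1 (le_trans (normc_le_norm2 _ _)).
have norm2_delta j : norm2 (delta_mx j 0 : 'cV[C]_m) <= 1.
  rewrite /norm2 (bigD1 j)//= big1 => [|i ij]; rewrite !mxE.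
    by rewrite !eqxx /= expr1n expr0n /= !addr0 sqrtr1.
  by rewrite (negPf ij) /= expr0n addr0.
have colle i j : normc (A i j) <= opnorm A.
  have -> : A i j = (A *m delta_mx j 0 : 'cV_m) i 0 by rewrite -colE mxE.
  apply: le_trans (normc_le_norm2 _ _) _; apply: ub_le_sup => //.
  by exists (delta_mx j 0) => //=.
have -> : (m * m)%:R * opnorm A = \sum_(i < m) \sum_(j < m) opnorm A.
  by rewrite !sumr_const !card_ord -mulrnA mulr_natl.
by apply: ler_sum => i _; apply: ler_sum => j _.
Qed.

End L1Norm.

(** * Rotations generated by an involution *)

Section Rotation.
Variables (R : realType) (m : nat).
Local Notation C := R[i].
Implicit Types (A B : 'M[C]_m) (c s t : R).

(** For an involution A and c = cos x, s = sin x, this is exp(i x A). *)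
Definition rot A c s : 'M[C]_m := c%:C%C *: 1%:M + ('i%C * s%:C%C) *: A.

(** The rational parametrisation of the circle, with angle 2 arctan t; for an involution A it equals
    (1 + itA) / (1 - itA). Integer values of t supply any number of distinct rotations. *)
Definition cayley A t := rot A ((1 - t ^+ 2) / (1 + t ^+ 2)) (2 * t / (1 + t ^+ 2)).

Let ii : ('i%C : C) * 'i%C = -1.
Proof. by rewrite -expr2 sqr_i. Qed.

Lemma rotM A c s c' s' : A *m A = 1%:M ->
  rot A c s *m rot A c' s' = rot A (c * c' - s * s') (c * s' + s * c').
Proof.
move=> AA; rewrite /rot mulmxDl !mulmxDr -!scalemxAl -!scalemxAr !mul1mx !mulmx1 AA.
move: (1%:M : 'M[C]_m) => I; apply/matrixP => x y; rewrite !mxE.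
move: (I x y) (A x y) => u v; ring: ii.
Qed.

Lemma rot_adj A c s : A ^t* = A -> (rot A c s) ^t* = rot A c (- s).
Proof.
move=> Ah; rewrite /rot linearD /= map_mxD !linearZ /= !map_mxZ.
rewrite trmx1 map_mx1 Ah; congr (_ *: _ + _ *: _).
  exact: conjc_real.
by rewrite rmorphM /=; apply/eqP; rewrite eq_complex /=; apply/andP; split; apply/eqP; ring.
Qed.

Lemma rot10 A : rot A 1 0 = 1%:M.
Proof. by rewrite /rot mulr0 scale0r addr0 scale1r. Qed.

Lemma rot_unitary A c s : A *m A = 1%:M -> A ^t* = A -> c ^+ 2 + s ^+ 2 = 1 ->
  rot A c s \is unitarymx.
Proof.
move=> AA Ah cs; apply/unitarymxP; rewrite rot_adj// rotM// -(rot10 A).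
by congr rot; [rewrite -cs|]; ring.
Qed.

Lemma rot_comm A c s B : comm_mx A B -> comm_mx (rot A c s) B.
Proof.
move=> AB; rewrite /comm_mx mulmxDl mulmxDr -!scalemxAl -!scalemxAr AB.
by rewrite mul1mx mulmx1.
Qed.

(** Scalar parts drop out of the commutator, and anticommutation doubles the remaining term. *)
Lemma rot_commutator A B c s c' s' : A *m B = - (B *m A) ->
  rot A c s *m rot B c' s' - rot B c' s' *m rot A c s = (- 2 * s * s')%:C%C *: (A *m B).
Proof.
move=> AB; rewrite /rot !mulmxDl !mulmxDr -!scalemxAl -!scalemxAr !mul1mx !mulmx1.
have -> : B *m A = - (A *m B) by rewrite AB opprK.
move: (1%:M : 'M[C]_m) (A *m B) => I D; apply/matrixP => x y; rewrite !mxE.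
move: (I x y) (A x y) (B x y) (D x y) => u v w z; ring: ii.
Qed.

Lemma cayley_den t : 1 + t ^+ 2 != 0.
Proof. by rewrite gt_eqF// ltr_pwDl// sqr_ge0. Qed.

Lemma cayley_unitary A t : A *m A = 1%:M -> A ^t* = A -> cayley A t \is unitarymx.
Proof.
by move=> AA Ah; apply: rot_unitary => //; have := cayley_den t => ?; field.
Qed.

(* [B] conjugates [1 + itA] into [1 - itA]: their determinants agree, so the
   Cayley transform, their quotient, has determinant 1. *)
Lemma cayley_det A B t : A *m A = 1%:M -> B *m B = 1%:M -> A *m B = - (B *m A) ->
  \det (cayley A t) = 1.
Proof.
move=> AA BB AB; have d0 := cayley_den t.
have conj s : \det (rot A 1 (- s)) = \det (rot A 1 s).
  have -> : rot A 1 (- s) = B *m rot A 1 s *m B.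
    rewrite /rot mulmxDr mulmxDl -!scalemxAr -!scalemxAl mulmx1 BB -mulmxA AB.
    by rewrite mulmxN mulmxA BB mul1mx scalerN rmorphN mulrN scaleNr.
  by rewrite !det_mulmx mulrAC -det_mulmx BB det1 mul1r.
have sq : rot A 1 t *m rot A 1 t = (1 + t ^+ 2)%:C%C *: cayley A t.
  rewrite rotM// /cayley /rot scalerDr !scalerA; congr (_ *: _ + _ *: _).
    by rewrite -rmorphM /=; congr (_ %:C)%C; field.
  by rewrite mulrCA -rmorphM /=; congr (_ * _ %:C)%C; field.
have sq' : rot A 1 t *m rot A 1 (- t) = (1 + t ^+ 2)%:C%C *: 1%:M.
  rewrite rotM// /rot; have -> : 1 * - t + t * 1 = 0 by ring.
  by rewrite mulr0 scale0r addr0; congr (_ %:C *: _)%C; ring.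
have := congr1 determinant sq'.
rewrite det_mulmx conj -det_mulmx sq !detZ det1.
by apply: mulfI; rewrite expf_neq0// fmorph_eq0.
Qed.

End Rotation.

(** The explicit coefficient is the sine of the difference of the angles 2 arctan a and 2 arctan
    b. *)
Lemma cayley_quotient (R : realType) m (A : 'M[R[i]]_m) (a b : R) :
    A *m A = 1%:M -> A ^t* = A ->
  exists c, cayley A a *m (cayley A b) ^t* =
    rot A c (2 * (a - b) * (1 + a * b) / ((1 + a ^+ 2) * (1 + b ^+ 2))).
Proof.
move=> AA Ah; rewrite /cayley rot_adj// rotM//; eexists; congr rot.
by have := cayley_den a; have := cayley_den b => ? ?; field; apply/andP.
Qed.

(** For distinct natural numbers up to M, both |a - b| and 1 + a b are at least 1, while the
    denominator is at most (1 + M^2)^2. *)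
Lemma cayley_separated (R : realType) M : exists2 kappa : R, 0 < kappa &
  forall a b : 'I_M.+1, a != b ->
  kappa <= `|2 * (a%:R - b%:R) * (1 + a%:R * b%:R) /
             ((1 + a%:R ^+ 2) * (1 + b%:R ^+ 2))|.
Proof.
pose D : R := (1 + M%:R ^+ 2) ^+ 2.
have D0 : 0 < D by rewrite exprn_gt0// ltr_pwDl// sqr_ge0.
exists (2 / D); first by rewrite divr_gt0.
move=> a b ab.
have dp (c : 'I_M.+1) : 0 < 1 + c%:R ^+ 2 :> R by rewrite ltr_pwDl// sqr_ge0.
have dle (c : 'I_M.+1) : 1 + c%:R ^+ 2 <= 1 + M%:R ^+ 2 :> R.
  by rewrite lerD2l ler_pXn2r ?nnegrE// ler_nat -ltnS.
have ab1 : 1 <= `|a%:R - b%:R| :> R.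
  wlog ba : a b ab / (b < a)%N.
    move=> H; case: (ltngtP a b) => [lt|lt|/val_inj e]; last by rewrite e eqxx in ab.
      by rewrite distrC; apply: H => //; rewrite eq_sym.
    exact: H.
  by rewrite -(natrB _ (ltnW ba)) ger0_norm ?ler0n// ler1n subn_gt0.
rewrite normrM normfV 2!normrM (ger0_norm (ler0n _ _)).
rewrite (gtr0_norm (mulr_gt0 (dp a) (dp b))).
have p1 : 1 <= `|1 + a%:R * b%:R| :> R.
  by rewrite -natrM -(natrD _ 1%N) ger0_norm ?ler0n// ler1n.
apply: ler_pM => //.
- by rewrite invr_ge0 ltW.
- by rewrite -mulrA ler_peMr// mulr_ege1.
- by rewrite lef_pV2 ?posrE ?D0 ?(mulr_gt0 (dp a) (dp b))// ler_pM// ltW.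
Qed.

(** * Rotations about anticommuting axes resist commuting approximations *)

Section Approximation.
Variables (R : realType) (m M : nat).
Local Notation C := R[i].

(** The exact quotients have commutator -2 s s' A B P, of norm at least 2 kappa^2 nu. If the
    approximate quotients commuted, this norm would be at most 8 K^3 e. *)
Lemma cayley_approx_contradiction (A B P : 'M[C]_m) :
    A *m A = 1%:M -> A ^t* = A -> B *m B = 1%:M -> B ^t* = B ->
    A *m B = - (B *m A) ->
    P *m P = P -> P ^t* = P -> comm_mx A P -> comm_mx B P -> P != 0 ->
  exists2 e : R, 0 < e & forall (a b c d : 'I_M.+1) (T T' : 'I_M.+1 -> 'M[C]_m),
    a != b -> c != d ->
    (forall k, T k \is unitarymx) -> (forall k, T' k \is unitarymx) ->
    (forall k : 'I_M.+1, l1norm (cayley A k%:R *m P - T k *m P) <= e) ->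
    (forall k : 'I_M.+1, l1norm (cayley B k%:R *m P - T' k *m P) <= e) ->
  ~ comm_mx (T a *m P *m (T b *m P) ^t*) (T' c *m P *m (T' d *m P) ^t*).
Proof.
move=> AA Ah BB Bh AB PP Ph AP BP P0.
have [kappa k0 kP] := cayley_separated R M.
pose nu := l1norm (A *m B *m P).
have nu0 : 0 < nu.
  rewrite lt_def l1norm_ge0 andbT; apply: contra P0 => /eqP/l1norm_eq0 ABP.
  have -> : P = B *m (A *m (A *m B *m P)).
    by rewrite !mulmxA -(mulmxA B A) AA mulmx1 BB mul1mx.
  by rewrite ABP !mulmx0.
pose K := (m * m)%:R * l1norm P.
have K0 : 0 <= K by rewrite mulr_ge0 ?l1norm_ge0.
have den : 0 < 8 * K ^+ 3 + 1 by rewrite ltr_wpDl// mulr_ge0// exprn_ge0.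
(* Chosen to make 8 K^3 e at most kappa^2 nu, half of the lower bound. *)
pose e := kappa ^+ 2 * nu / (8 * K ^+ 3 + 1).
have e0 : 0 < e by rewrite divr_gt0// mulr_gt0// exprn_gt0.
exists e => // a b c d T T' ab cd Tu T'u TA T'B YC.
have bound (U : 'M[C]_m) : U \is unitarymx -> l1norm (U *m P) <= K.
  move=> Uu; apply: le_trans (l1normM _ _) _.
  by rewrite ler_wpM2r ?l1norm_ge0 ?l1norm_unitary.
have pair (E : 'M[C]_m) (U : 'I_M.+1 -> 'M[C]_m) (a' b' : 'I_M.+1) :
    E *m E = 1%:M -> E ^t* = E -> comm_mx E P -> (forall k, U k \is unitarymx) ->
    (forall k : 'I_M.+1, l1norm (cayley E k%:R *m P - U k *m P) <= e) -> a' != b' ->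
    let x := cayley E a'%:R *m P *m (cayley E b'%:R *m P) ^t* in
    let y := U a' *m P *m (U b' *m P) ^t* in
    [/\ l1norm x <= K ^+ 2, l1norm y <= K ^+ 2, l1norm (x - y) <= 2 * K * e &
        exists g s, [/\ kappa <= `|s| & x = rot E g s *m P]].
  move=> EE Eh EP Uu UE ab' x y.
  have xK (k : 'I_M.+1) : l1norm (cayley E k%:R *m P) <= K by apply/bound/cayley_unitary.
  have yK k : l1norm (U k *m P) <= K by apply: bound.
  split.
  - by rewrite (le_trans (l1normM _ _))// l1norm_adj expr2 ler_pM ?l1norm_ge0.
  - by rewrite (le_trans (l1normM _ _))// l1norm_adj expr2 ler_pM ?l1norm_ge0.
  - have -> : 2 * K * e = K * e + e * K by ring.
    apply: l1norm_mulB => //; first by rewrite l1norm_adj.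
    by rewrite -map_mxB -linearB l1norm_adj.
  have [g gE] := cayley_quotient a'%:R b'%:R EE Eh.
  set s := (X in rot E g X) in gE; exists g, s; split; first exact: kP.
  rewrite -gE /x adj_mul Ph -!mulmxA (mulmxA P P) PP.
  have : comm_mx (cayley E b'%:R) P by apply: rot_comm.
  by move=> /comm_mx_adj; rewrite Ph => ->.
have [xK yK xy [g [s [ks xE]]]] := pair A T a b AA Ah AP Tu TA ab.
have [xK' yK' xy' [g' [s' [ks' xE']]]] := pair B T' c d BB Bh BP T'u T'B cd.
move: xK yK xy xE xK' yK' xy' xE' YC.
set x := cayley A _ *m _ *m _; set x' := cayley B _ *m _ *m _.
set y := T a *m _ *m _; set y' := T' c *m _ *m _.
clearbody x x' y y'; move=> xK yK xy xE xK' yK' xy' xE' YC.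
have lower : x *m x' - x' *m x = (- 2 * s * s')%:C%C *: (A *m B *m P).
  have mulP E F g1 s1 g2 s2 : comm_mx F P ->
      rot E g1 s1 *m P *m (rot F g2 s2 *m P) = rot E g1 s1 *m rot F g2 s2 *m P.
    move=> /(rot_comm g2 s2) FP.
    by rewrite -mulmxA (mulmxA P) -FP -(mulmxA _ P) PP mulmxA.
  by rewrite xE xE' scalemxAl -(rot_commutator g s g' s' AB) mulmxBl !mulP.
(* As [y] and [y'] commute, the commutator is a difference of two errors, each at most twice K^2 (2
   K e). *)
have upper : l1norm (x *m x' - x' *m x) <= 8 * K ^+ 3 * e.
  have -> : x *m x' - x' *m x = (x *m x' - y *m y') - (x' *m x - y' *m y).
    by rewrite YC opprB addrA subrK.
  apply: le_trans (l1normB _ _) _.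
  have -> : 8 * K ^+ 3 * e =
     (K ^+ 2 * (2 * K * e) + 2 * K * e * K ^+ 2) +
     (K ^+ 2 * (2 * K * e) + 2 * K * e * K ^+ 2) by ring.
  exact: lerD (l1norm_mulB xK yK' xy xy') (l1norm_mulB xK' yK xy' xy).
have big : 2 * kappa ^+ 2 * nu <= l1norm (x *m x' - x' *m x).
  rewrite lower l1normZ -/nu ler_pM2r//= expr0n addr0 sqrtr_sqr 2!normrM normrN.
  rewrite (ger0_norm (ler0n _ 2)) -mulrA ler_pM2l// expr2.
  by rewrite ler_pM// ltW.
have small : 8 * K ^+ 3 * e <= kappa ^+ 2 * nu.
  rewrite /e mulrA ler_pdivrMr// mulrC ler_pM2l ?mulr_gt0 ?exprn_gt0//; lra.
have : 0 < kappa ^+ 2 * nu by rewrite mulr_gt0// exprn_gt0.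
lra.
Qed.

End Approximation.

(** * Gates on blocks *)

Section Gates.
Variables (R : realType) (n : nat) (S : set (qop R 'I_n)).
Hypotheses (St : is_stabilizer S) (Sfin : finite_set S).

Section Placed.
Variable r : nat.
Local Notation P := (block_projector S r).
Local Notation column := (@in_column n r).

Definition transversal (T : qop R ('I_r * 'I_n)%type) : Prop :=
  exists V : 'I_n -> qop R 'I_r,
    [/\ forall j, V j \is unitarymx, T = tensor_op column V & comm_mx T P].

(* The dummy index makes a relabelling of all qubits a tensor product with one
   factor, to which the lemmas on [local] apply. *)
Definition relabel (J T : finType) (f : J -> T) (_ : unit) : J -> T := f.

Lemma relabel_bij (J T : finType) (f : J -> T) : bijective f ->
  bijective (fun p => relabel f p.1 p.2).
Proof.
move=> [g fK gK]; exists (fun t => (tt, g t)) => [[[] j]|t] /=; last exact: gK.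
by rewrite fK.
Qed.

Lemma entry_relabel (J T : finType) (f : J -> T) (D : qop R J) x y :
  entry (local (relabel f) tt D) x y = entry D (restr f x) (restr f y).
Proof.
rewrite entry_local; case: forallP => [_|[]]; first by rewrite mulr1.
by case.
Qed.

(** With exactly r blocks, a placement permutes the blocks. This relabels qubits within each column,
    and it fixes [P] because all blocks carry the same projector. *)
Lemma placed_transversal V : placed (N := r) (trans_gates S r) V -> transversal V.
Proof.
move=> [f [W [f_inj [[_ WP] [U [Uu WE]]] VE]]].
have [g fK gK] := injF_bij f_inj.
have fB : bijective f by exists g.
pose F (p : 'I_r * 'I_n) := (f p.1, p.2).
have FB : bijective F.
  by exists (fun p => (g p.1, p.2)) => -[b j]; rewrite /F /= ?fK ?gK.
have {}VE : V = local (relabel F) tt W.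
  by rewrite VE -(act_on_local (relabel_bij FB)).
exists (fun j => local (relabel f) tt (U j)); split.
- move=> j; apply: (tensor_unitary (relabel_bij fB)) => -[] /=.
  by case: (Uu j).
- rewrite VE; apply: qop_eq => x y; rewrite entry_relabel WE !entry_tensor.
  apply: eq_bigr => j _; rewrite entry_relabel.
  by congr (entry _ _ _); apply/ffunP => b; rewrite !ffunE.
have PE : P = local (relabel F) tt P.
  apply: qop_eq => x y; rewrite entry_relabel !entry_tensor.
  rewrite (reindex f) /=; last exact: onW_bij.
  apply: eq_bigr => b _.
  by congr (entry _ _ _); apply/ffunP => j; rewrite !ffunE.
by rewrite VE PE; apply: (local_comm (relabel_bij FB)) => _; apply: WP.
Qed.

Lemma transversal_prod (Vs : seq (qop R ('I_r * 'I_n)%type)) :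
  (forall V, V \in Vs -> transversal V) ->
  transversal (\big[mulmx/1%:M]_(V <- Vs) V).
Proof.
elim: Vs => [_|V Vs IH VsP].
  rewrite big_nil; exists (fun=> 1%:M); split.
  - by move=> j; apply/unitarymxP; rewrite adj1 mulmx1.
  - by rewrite (tensor_1 _ (@in_column_bij n r)).
  - exact/comm_mx_sym/comm_mx1.
rewrite big_cons; have [U [Uu UE UP]] := VsP V (mem_head _ _).
have [|U' [U'u U'E U'P]] := IH.
  by move=> W WVs; apply: VsP; rewrite in_cons WVs orbT.
exists (fun j => U j *m U' j); split.
- by move=> j; rewrite mul_unitarymx.
- by rewrite UE {1}U'E (tensor_mul (@in_column_bij n r)).
- by apply: comm_mx_sym; apply: comm_mxM; apply: comm_mx_sym.
Qed.

(** A product of placed gates is again transversal, so one transversal operator replaces the whole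
    sequence. The tolerance is divided to pay for passing from [opnorm] to [l1norm]. *)
Lemma approximable_transversal U (e : R) : 0 < e ->
  approximable S (placed (N := r) (trans_gates S r)) U ->
  exists V : 'I_n -> qop R 'I_r,
    [/\ forall j, V j \is unitarymx, comm_mx (tensor_op column V) P &
        l1norm (U *m P - tensor_op column V *m P) <= e].
Proof.
move=> e0 Uapp; pose m := #|{ffun 'I_r * 'I_n -> bool}|.
have m0 : 0 < (m * m).+1%:R :> R by rewrite ltr0n.
have [Vs [VsP VsU]] := Uapp _ (divr_gt0 e0 m0).
have [|V [Vu VE VP]] := @transversal_prod Vs.
  by move=> V /VsP; apply: placed_transversal.
exists V; split; [exact: Vu | by rewrite -VE|rewrite -VE].
apply: le_trans (l1norm_opnorm _) _; apply: le_trans (ler_wpM2l (ler0n _ _) (ltW VsU)) _.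
by rewrite mulrA ler_pdivrMr// mulrC ler_pM2l// ler_nat.
Qed.
End Placed.

Lemma logical_involution_herm (A : qop R 'I_n) :
  pauli_group A -> A *m A = 1%:M -> A ^t* = A.
Proof.
move=> /pauli_unitary/unitary_adjl Au AA.
by rewrite -[LHS]mulmx1 -AA mulmxA Au mul1mx.
Qed.

(** The anticommuting partner [B] supplies determinant 1 through [cayley_det]. *)
Lemma cayley_logical_gate N b (A B : qop R 'I_n) t :
    pauli_group A -> comm_mx A (projector S) ->
    A *m A = 1%:M -> B *m B = 1%:M -> A *m B = - (B *m A) ->
  logical_gates S N (cayley (local (@in_block n N) b A) t).
Proof.
move=> Ap AQ AA BB AB; have pB := @in_block_bij n N.
have AA' : local (@in_block n N) b A *m local (@in_block n N) b A = 1%:M.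
  by rewrite -(localM pB) AA (local_1 _ pB).
split; last by apply: rot_comm; apply: block_projector_local.
split.
  by apply: cayley_unitary; rewrite // local_adj logical_involution_herm.
apply: (@cayley_det _ _ _ (local (@in_block n N) b B)) => //.
  by rewrite -(localM pB) BB (local_1 _ pB).
by rewrite -!(localM pB) AB -scaleN1r localZ scaleN1r.
Qed.

End Gates.

(** * The contradiction with universality *)

Theorem theorem2 (R : realType) (n k r : nat) (S : set (qop R 'I_n))
    (X Z : 'I_k -> qop R 'I_n) (q : 'I_k) :
  (k <= n)%N ->
  is_stabilizer S ->
  (S #= `I_(2 ^ (n - k)))%card ->
  free_of_bell_pairs S ->
  free_of_trivial_qubits S ->
  logical_paulis S X Z ->
  (1 <= r)%N ->
  ~ universal_for_logical_qubit S X Z q (trans_gates S r).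
Proof.
move=> _ St Scard _ Snontriv [XZc XZ1 XXZZ XZ] r0 univ.
have Sfin : finite_set S by exists (2 ^ (n - k))%N.
pose b0 : 'I_r := Ordinal r0.
pose P := block_projector S r.
have [M MP] := transversal_pigeonhole r St Sfin Snontriv.
have pB := @in_block_bij n r.
pose L (A : qop R 'I_n) := local (@in_block n r) b0 A.
have anti : X q *m Z q = - (Z q *m X q) by rewrite XZ eqxx expr1 scaleN1r.
have [[[Xp Xc] [Zp Zc]] [X1 Z1]] := (XZc q, XZ1 q).
have XQ : comm_mx (X q) (projector S) by apply: projector_comm.
have ZQ : comm_mx (Z q) (projector S) by apply: projector_comm.
have LL A : A *m A = 1%:M -> L A *m L A = 1%:M.
  by move=> AA; rewrite -(localM pB) AA (local_1 _ pB).
have Lh A : pauli_group A -> A *m A = 1%:M -> (L A) ^t* = L A.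
  by move=> Ap AA; rewrite local_adj logical_involution_herm.
have Lanti : L (X q) *m L (Z q) = - (L (Z q) *m L (X q)).
  by rewrite -!(localM pB) anti -scaleN1r localZ scaleN1r.
(* The precision [e] is chosen after [M], for the logical X and Z of qubit [q] placed in block
   [b0]. *)
have [e e0 eP] := cayley_approx_contradiction M (LL _ X1) (Lh _ Xp X1) (LL _ Z1)
  (Lh _ Zp Z1) Lanti (block_projector_idem r St Sfin)
  (block_projector_herm r St Sfin) (block_projector_local b0 XQ)
  (block_projector_local b0 ZQ) (block_projector_neq0 r St Sfin).
have approx A B : pauli_group A -> comm_mx A (projector S) ->
    A *m A = 1%:M -> B *m B = 1%:M -> A *m B = - (B *m A) ->
    (forall i, i != q -> comm_mx A (X i) /\ comm_mx A (Z i)) ->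
    exists V : 'I_M.+1 -> 'I_n -> qop R 'I_r, forall a : 'I_M.+1,
      [/\ forall j, V a j \is unitarymx,
          comm_mx (tensor_op (@in_column n r) (V a)) P &
          l1norm (cayley (L A) a%:R *m P - tensor_op (@in_column n r) (V a) *m P) <= e].
  move=> Ap AQ AA BB AB Aq.
  suff app (a : 'I_M.+1) : approximable S
      (placed (N := r) (trans_gates S r)) (cayley (L A) a%:R).
    have [V VP] := choice (fun a => approximable_transversal e0 (app a)).
    by exists V.
  (* Universality is used on N = r blocks, where [placed_transversal] applies. *)
  apply: univ => //; first exact: cayley_logical_gate BB AB.
  (* In block [b0] the generator [A] commutes with the logical Paulis of index other than [q]; in
     the other blocks the supports are disjoint. *)
  move=> b i iq D DXZ Db; congr (_ *m _); apply: rot_comm.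
  have -> : Db = local (@in_block n r) b D by rewrite -(act_on_local pB).
  apply: (local_comm pB) => _.
  by have [AX AZ] := Aq i iq; case: DXZ => ->.
have [|V VP] := approx (X q) (Z q) Xp XQ X1 Z1 anti.
  move=> i iq; split; first by have [] := XXZZ q i.
  by rewrite /comm_mx XZ eq_sym (negPf iq) expr0 scale1r.
have [||V' V'P] := approx (Z q) (X q) Zp ZQ Z1 X1.
- by rewrite anti opprK.
- move=> i iq; split; last by have [] := XXZZ q i.
  by rewrite /comm_mx XZ (negPf iq) expr0 scale1r.
have [|||| a [b [c [d [ab cd]]]]] := MP V V'.
- by move=> a j; have [] := VP a.
- by move=> a j; have [] := V'P a.
- by move=> a; have [] := VP a.
- by move=> a; have [] := V'P a.
have Tu (U : 'I_M.+1 -> 'I_n -> qop R 'I_r) k0 : (forall j, U k0 j \is unitarymx) ->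
    tensor_op (@in_column n r) (U k0) \is unitarymx.
  by move=> Uu; apply: (tensor_unitary (@in_column_bij n r)).
pose T (U : 'I_M.+1 -> 'I_n -> qop R 'I_r) k0 := tensor_op (@in_column n r) (U k0).
apply: (eP a b c d (T V) (T V')) => // k0; first by apply: Tu; have [] := VP k0.
- by apply: Tu; have [] := V'P k0.
- by have [] := VP k0.
- by have [] := V'P k0.
Qed.
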